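(* There exists a $\lambda$-ring structure on $\mathrm{PQSym}$ such that the map $\vartheta:\mathrm{QSym}\to\mathrm{PQSym}$ is a morphism of $\lambda$-rings. Its corresponding Adams operations are the ring endomorphisms $\Phi^n$ ($n\in\mathbb{N}$) of $\mathrm{PQSym}$ determined by $$\Phi^n(L_\alpha)=\begin{cases}L_{n\cdot\alpha},&\text{if } n \text{ is odd},\\ 0,&\text{if } n\text{ is even},\end{cases}\qquad \alpha\in\mathscr{C}_{\mathrm{o}}.$$ In particular, the ring $\Gamma$ is a $\lambda$-subring of $\mathrm{PQSym}$.
   Context: $\mathbb{N}$ is the set of positive integers; $[n]=\{1,\dots,n\}$. A composition $\alpha=(\alpha_1,\dots,\alpha_r)$ of $n\ge 1$, written $\alpha\vDash n$, is an ordered tuple of positive integers with sum $n$; $D(\alpha)=\{\alpha_1,\alpha_1+\alpha_2,\dots,\alpha_1+\cdots+\alpha_{r-1}\}\subseteq[n-1]$. $\mathscr{C}_{\mathrm{o}}$ is the set of nonempty compositions all of whose parts are odd. For $k\in\mathbb{N}$, $k\cdot\alpha=(k\alpha_1,\dots,k\alpha_r)$. QSym: in $\mathbb{Z}[[x_1,x_2,\dots]]$ put $M_\alpha=\sum_{i_1<\cdots<i_r}x_{i_1}^{\alpha_1}\cdots x_{i_r}^{\alpha_r}$ and, for $\alpha\vDash n$, $F_\alpha=\sum x_{i_1}\cdots x_{i_n}$ over all $i_1\le\cdots\le i_n$ with $i_k<i_{k+1}$ whenever $k\in D(\alpha)$. QSym is the subring with $\mathbb{Z}$-basis $1$ and all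 $M_\alpha$ (equivalently $1$ and all $F_\alpha$). PQSym: a peak subset of $[n-1]$ is a set $P\subseteq\{2,\dots,n-1\}$ such that $i\in P$ implies $i-1\notin P$. For such $P$ put $K_P=2^{|P|+1}\sum F_\alpha$, the sum over all $\alpha\vDash n$ with $P\subseteq D(\alpha)\triangle(D(\alpha)+1)$, where $D+1=\{x+1:x\in D\}$ and $\triangle$ is symmetric difference ($K_P$ depends on $n$ as well). PQSym is the subring of QSym with $\mathbb{Z}$-basis $1$ and all $K_P$ ($n\geq 1$, $P$ a peak subset of $[n-1]$). For $\alpha\vDash n$ let $P(\alpha)=\{i\in D(\alpha)\cap\{2,\dots,n-1\}: i-1\notin D(\alpha)\}$. There is a surjective ring homomorphism $\vartheta:\mathrm{QSym}\to\mathrm{PQSym}$, $F_\alpha\mapsto K_{P(\alpha)}$ (and $1\mapsto 1$). The monomial peak functions are $L_\alpha=\vartheta(M_\alpha)$, $\alpha\in\mathscr{C}_{\mathrm{o}}$; together with $1$ they form a $\mathbb{Z}$-basis of PQSym. $\Gamma$ is the subring of symmetric functions (a subring of PQSym) generated by the $q_n$, $n\ge1$, where $\sum_{n\ge0}q_nz^n=\prod_{i\ge1}\frac{1+x_iz}{1-x_iz}$. $\lambda$-rings: for a $\lambda$-ring $R$ with operations $\lambda^i$, the Adams operations $\Psi^n:R\to R$ are defined by $\frac{d}{dt}\log\lambda_t(a)=\sum_{n\ge0}(-1)^n\Psi^{n+1}(a)t^n$, where $\lambda_t(a)=1+\lambda^1(a)t+\lambda^2(a)t^2+\cdots$; they are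 ring endomorphisms with $\Psi^1=\mathrm{id}$ and $\Psi^m\circ\Psi^n=\Psi^{mn}$. A morphism of $\lambda$-rings is a ring homomorphism commuting with the operations $\lambda^i$. QSym carries the $\lambda$-ring structure whose Adams operations are $\Psi^n(M_\alpha)=M_{n\cdot\alpha}$ for all compositions $\alpha$ and $n\in\mathbb{N}$ (induced from the $\lambda$-structure on $\mathbb{Z}[[x_1,x_2,\dots]]$ with $\lambda^1(x_j)=x_j$, $\lambda^i(x_j)=0$ for $i\ge2$). *)

(* Defs.v *)
From HB Require Import structures.
From mathcomp Require Import all_boot all_order all_algebra finmap.
From mathcomp Require Import boolp classical_sets functions cardinality fsbigop.
From mathcomp Require Import monalg mpoly.

Set Implicit Arguments.
Unset Strict Implicit.
Unset Printing Implicit Defensive.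

Import GRing.Theory.

Local Open Scope ring_scope.

(* Z[[x_1, x_2, ...]]: arbitrary integer-valued functions on the monomials in *)
(* countably many variables, with convolution as product.  The variables are  *)
(* indexed by nat, so the variable called x_(i+1) on paper has index i.       *)
Definition psring := {cmonom nat} -> int.

#[warnings="-redundant-canonical-projection"]
HB.instance Definition _ := GRing.Zmodule.copy psring ({cmonom nat} -> int).

(* The set of factorizations of a monomial is finite (divisors_finite), so    *)
(* this finitely supported sum is the Cauchy product.                         *)
Definition ps_mul (f g : psring) : psring := fun m =>
  \sum_(p \in [set p : {cmonom nat} * {cmonom nat} | mmul p.1 p.2 = m]%classic)
    f p.1 * g p.2.

Definition ps_one : psring := fun m => (m == mone)%:R.

Section PsRing.
Implicit Types (f g h : psring) (m : {cmonom nat}).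

Lemma divisors_finite m :
  {B : seq {cmonom nat} | uniq B & forall a b, mmul a b = m -> a \in B}.
Proof.
pose F (u : {ffun finsupp m -> 'I_(monalg.mdeg m).+1}) : {cmonom nat} :=
  mkcmonom [fsfun i : finsupp m => (u i : nat) | 0%N].
exists (undup [seq F u | u : {ffun finsupp m -> 'I_(monalg.mdeg m).+1}]).
  exact: undup_uniq.
move=> a b abm; rewrite mem_undup.
have le i : (a i <= m i)%N by rewrite -abm cmM leq_addr.
have led i : (a i <= monalg.mdeg m)%N.
  case: (mdomP m i) (le i) => [im|_]; last by rewrite leqn0 => /eqP->.
  move=> /leq_trans; apply; rewrite monalg.mdegE (big_fsetD1 i) //=.
  exact: leq_addr.
apply/mapP; exists [ffun i : finsupp m => inord (a (val i))].
  by rewrite mem_enum.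
apply/eqP/cmP => i; rewrite cmE fsfun_ffun.
case: insubP => [j jm ji|im] /=.
  by rewrite ffunE /= inordK ?ltnS ?led// -ji.
by apply/eqP; rewrite -leqn0 (leq_trans (le i)) // leqn0 cmE_eq0.
Qed.

Lemma ps_mulE m (B : seq {cmonom nat}) f g : uniq B ->
    (forall a b, mmul a b = m -> a \in B) ->
  ps_mul f g m = \sum_(a <- B) \sum_(b <- B | mmul a b == m) f a * g b.
Proof.
move=> uB hB; rewrite /ps_mul (fsbigE [seq p <- [seq (a, b) | a <- B, b <- B]
  | mmul p.1 p.2 == m]); first last.
- move=> [a b] /= abm; rewrite mem_filter /= abm eqxx /= => /negP[].
  apply/allpairsP; exists (a, b); split => //=; first exact: hB abm.
  by apply: (hB b a); rewrite mulmC.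
- by move=> p /=; rewrite mem_filter => /andP[/eqP].
- by apply/filter_uniq/allpairs_uniq => // -[? ?] [? ?].
rewrite big_mkcond big_filter big_mkcond big_allpairs /=.
apply: eq_bigr => a _; rewrite [RHS]big_mkcond /=; apply: eq_bigr => b _ /=.
case: eqP => // abm; case: ifPn => //.
by rewrite notin_setE.
Qed.

Lemma ps_mulA3 m (B : seq {cmonom nat}) f g h : uniq B ->
    (forall a b, mmul a b = m -> a \in B) ->
  ps_mul f (ps_mul g h) m =
  \sum_(a <- B) \sum_(b <- B) \sum_(c <- B | mmul a (mmul b c) == m)
    f a * (g b * h c).
Proof.
move=> uB hB; rewrite (ps_mulE _ _ uB hB); apply: eq_bigr => a _.
transitivity (\sum_(d <- B | mmul a d == m) \sum_(b <- B)
    \sum_(c <- B | mmul b c == d) f a * (g b * h c)).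
  apply: eq_bigr => d /eqP adm; rewrite (ps_mulE _ _ uB) => [|b c bcd].
    by rewrite mulr_sumr; apply: eq_bigr => b _; rewrite mulr_sumr.
  by apply: (hB b (mmul a c)); rewrite mulmA (mulmC b) -mulmA bcd.
rewrite exchange_big; apply: eq_bigr => b _ /=.
rewrite (exchange_big_dep xpredT) //= [RHS]big_mkcond /=.
apply: eq_bigr => c _; case: eqP => [abcm|abcm].
  rewrite (big_rem (mmul b c)) /=; last by apply: (hB _ a); rewrite mulmC.
  rewrite abcm !eqxx /= big1_seq ?addr0// => d /andP[/andP[_ /eqP<-]].
  by rewrite mem_rem_uniqF.
by rewrite big1// => d /andP[/eqP adm /eqP bcd]; case: abcm; rewrite bcd.
Qed.

Lemma ps_mulC : commutative ps_mul.
Proof.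
move=> f g; apply/funext => m; have [B uB hB] := divisors_finite m.
rewrite !(ps_mulE _ _ uB hB) [RHS](exchange_big_dep xpredT) //=.
apply: eq_bigr => a _; rewrite [LHS]big_mkcond [RHS]big_mkcond /=.
by apply: eq_bigr => b _; rewrite mulmC mulrC.
Qed.

Lemma ps_mulA : associative ps_mul.
Proof.
move=> f g h; rewrite [RHS]ps_mulC; apply/funext => m.
have [B uB hB] := divisors_finite m; rewrite !(ps_mulA3 _ _ _ uB hB).
rewrite [RHS]exchange_big /=; apply: eq_bigr => a _.
rewrite [RHS](exchange_big_dep xpredT) //=; apply: eq_bigr => b _.
rewrite [LHS]big_mkcond [RHS]big_mkcond /=; apply: eq_bigr => c _.
by rewrite mulmA (mulmC c) mulrA (mulrC (h c)).
Qed.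

Lemma ps_mul1 : left_id ps_one ps_mul.
Proof.
move=> f; apply/funext => m; have [B uB hB] := divisors_finite m.
rewrite (ps_mulE _ _ uB hB) (exchange_big_dep xpredT) //= (bigD1_seq m) //=; last first.
  by apply: (hB m mone); rewrite mulm1.
rewrite [X in X + _]big_mkcond (bigD1_seq mone) //=; last first.
  by apply: (hB mone m); rewrite mul1m.
rewrite mul1m eqxx /ps_one eqxx mul1r big1 ?addr0 => [|a /negPf->]; last first.
  by rewrite mul0r if_same.
rewrite big1 ?addr0 // => b bm; rewrite big1 // => a /eqP abm.
case: eqP => [a1|_]; last by rewrite mul0r.
by move: bm; rewrite -abm a1 mul1m eqxx.
Qed.

Lemma ps_mulDl : left_distributive ps_mul +%R.
Proof.
move=> f g h; apply/funext => m; have [B uB hB] := divisors_finite m.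
rewrite [RHS]/GRing.add /= !(ps_mulE _ _ uB hB) -big_split /=.
by apply: eq_bigr => a _; rewrite -big_split /=; apply: eq_bigr => b _; rewrite mulrDl.
Qed.

Lemma ps_one_neq0 : ps_one != 0.
Proof. by apply/eqP => /(congr1 (fun f : psring => f mone)); rewrite /ps_one eqxx. Qed.

End PsRing.

#[warnings="-redundant-canonical-projection"]
HB.instance Definition _ := GRing.Zmodule_isComNzRing.Build psring
  ps_mulA ps_mulC ps_mul1 ps_mulDl ps_one_neq0.

(* The formal sum of the monomials in S, each taken once. *)
Definition ps_sum (S : set {cmonom nat}) : psring := fun m => (m \in S)%:R.

Definition ps_var (i : nat) : psring := ps_sum [set ucm i]%classic.

(* x_(i_1)^(a_1) ... x_(i_r)^(a_r) *)
Definition monomial (i a : seq nat) : {cmonom nat} :=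
  \big[mmul/mone]_(p <- zip i a) expcmn (ucm p.1) p.2.

Definition composition (al : seq nat) : bool :=
  (al != [::]) && all (leq 1) al.

Definition odd_composition (al : seq nat) : bool := composition al && all odd al.

Definition scale_comp (k : nat) (al : seq nat) : seq nat := [seq (k * a)%N | a <- al].

(* The total sum is not among the partial sums making up D(alpha). *)
Definition Dset (al : seq nat) : seq nat :=
  [seq sumn (take k al) | k <- iota 1 (size al).-1].

(* In qsM and qsF distinct admissible index sequences give distinct           *)
(* monomials, so that all the coefficients are 0 or 1.  The k-th index, for k *)
(* in [n], is nth 0 i k.-1.                                                   *)
Definition qsM (al : seq nat) : psring :=
  ps_sum [set monomial i al | i in
    [set i : seq nat | size i = size al /\ sorted ltn i]]%classic.

Definition qsF (al : seq nat) : psring :=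
  ps_sum [set monomial i (nseq (size i) 1%N) | i in
    [set i : seq nat | [/\ size i = sumn al, sorted leq i &
       forall k, k \in Dset al -> (nth 0%N i k.-1 < nth 0%N i k)%N]]]%classic.

Definition zspan (R : zmodType) (X : set R) : {pred R} := fun x =>
  `[< exists s : seq (int * R),
        (forall p, p \in s -> X p.2) /\ x = \sum_(p <- s) p.2 *~ p.1 >].

Definition QSym : {pred psring} :=
  zspan [set f | f = 1 \/ exists2 al, composition al & f = qsM al]%classic.

(* Subsets of [n-1] are represented inside 'I_n, each element standing for    *)
(* its own value.                                                             *)
Definition peak_subset (n : nat) (P : {set 'I_n}) : Prop :=
  forall i, i \in P ->
    (2 <= i)%N /\ forall j, j \in P -> (j : nat) <> i.-1.

(* be is a composition of n and P is contained in the symmetric difference of *)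
(* D(be) and D(be) + 1.                                                       *)
Definition peak_index (n : nat) (P : {set 'I_n}) (be : seq nat) : bool :=
  [&& composition be, sumn be == n &
      [forall i in P,
         ((i : nat) \in Dset be) (+) ((i : nat) \in map succn (Dset be))]].

(* A composition of n has at most n parts, each of them at most n, which is   *)
(* why the sum ranges over bounded sequences.                                 *)
Definition peakK (n : nat) (P : {set 'I_n}) : psring :=
  (\sum_(b : n.-bseq 'I_n.+1 | peak_index P (map val b)) qsF (map val b))
    *+ 2 ^ #|P|.+1.

Definition PQSym : {pred psring} :=
  zspan [set f | f = 1 \/
    exists n (P : {set 'I_n}), [/\ (0 < n)%N, peak_subset P & f = peakK P]]%classic.

Definition peaks (al : seq nat) : {set 'I_(sumn al)} :=
  [set i : 'I_(sumn al) | [&& (2 <= i)%N, (i : nat) \in Dset al & i.-1 \notin Dset al]].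

(* The coefficient of a monomial m in q_n is read off from the product over   *)
(* the variables up to the last one occurring in m; the series                *)
(* 1 / (1 - x_i z) is truncated after z^n.                                    *)
Definition gammaq (n : nat) : psring := fun m =>
  (\prod_(i < (\max_(j <- finsupp m) j).+1)
      ((1 + (ps_var i)%:P * 'X) * \poly_(k < n.+1) (ps_var i ^+ k)))`_n m.

Definition Gamma : {pred psring} := fun f =>
  `[< forall S : {pred psring}, subring_closed S ->
        (forall n, (0 < n)%N -> gammaq n \in S) -> f \in S >].

(* Ring homomorphisms and lambda-ring structures are taken on subrings S of a *)
(* commutative ring R; the values outside S are irrelevant.                   *)
Definition ring_hom_on (R R' : comNzRingType) (S : {pred R}) (S' : {pred R'})
    (f : R -> R') : Prop :=
  [/\ {in S, forall x, f x \in S'}, f 1 = 1,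
      {in S &, {morph f : x y / x + y}} & {in S &, {morph f : x y / x * y}}].

Section Lambda.

Definition esymf (R : comNzRingType) (I : finType) (v : I -> R) (k : nat) : R :=
  \sum_(A : {set I} | #|A| == k) \prod_(i in A) v i.

(* Value of an integer polynomial at elements of a commutative ring. *)
Definition zeval (R : comNzRingType) (n : nat) (v : 'I_n -> R)
    (P : mpoly n int) : R := mpoly.mmap (fun z : int => z%:~R) v P.

(* The same for a polynomial in two groups of n variables, the i-th variable  *)
(* of each group (numbered from 1) being replaced by u i, resp. v i.          *)
Definition zeval2 (R : comNzRingType) (n : nat) (u v : nat -> R)
    (P : mpoly (n + n) int) : R :=
  zeval (fun k => match fintype.split k with inl i => u i.+1 | inr i => v i.+1 end) P.

(* P is the universal polynomial P_n: substituting the elementary symmetric   *)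
(* functions of xi_1, ..., xi_n and of eta_1, ..., eta_n gives the            *)
(* coefficient of t^n in the product of the 1 + xi_i eta_j t.                 *)
Definition is_univ_mul (n : nat) (P : mpoly (n + n) int) : Prop :=
  let xi (i : 'I_n) : mpoly (n + n) int := 'X_(lshift n i) in
  let eta (j : 'I_n) : mpoly (n + n) int := 'X_(rshift n j) in
  zeval2 (esymf xi) (esymf eta) P =
  (\prod_(i < n) \prod_(j < n) (1 + (xi i * eta j)%:P * 'X))`_n.

(* P is the universal polynomial P_(m,n): substituting the elementary         *)
(* symmetric functions of xi_1, ..., xi_(mn) gives the coefficient of t^m in  *)
(* the product, over i_1 < ... < i_n, of the 1 + xi_(i_1) ... xi_(i_n) t.     *)
Definition is_univ_comp (m n : nat) (P : mpoly (m * n) int) : Prop :=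
  let xi (i : 'I_(m * n)) : mpoly (m * n) int := 'X_i in
  zeval (fun i => esymf xi i.+1) P =
  (\prod_(A : {set 'I_(m * n)} | #|A| == n)
     (1 + (\prod_(i in A) xi i)%:P * 'X))`_m.

Record lambda_ring_on (R : comNzRingType) (S : {pred R})
    (lam : nat -> R -> R) : Prop := LambdaRingOn {
  lambda_subringP : subring_closed S;
  lambda_closed : forall n, {in S, forall x, lam n x \in S};
  lambda_0 : {in S, forall x, lam 0%N x = 1};
  lambda_1 : {in S, forall x, lam 1%N x = x};
  lambda_add : forall n, {in S &, forall x y,
    lam n (x + y) = \sum_(i < n.+1) lam i x * lam (n - i)%N y};
  lambda_one : forall n, (2 <= n)%N -> lam n 1 = 0;
  lambda_mul : forall n, exists2 P : mpoly (n + n) int, is_univ_mul P &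
    {in S &, forall x y, lam n (x * y) = zeval2 (lam^~ x) (lam^~ y) P};
  lambda_comp : forall m n, exists2 P : mpoly (m * n) int, is_univ_comp P &
    {in S, forall x, lam m (lam n x) = zeval (fun i => lam i.+1 x) P}
}.

Definition lambda_hom_on (R R' : comNzRingType)
    (S : {pred R}) (lam : nat -> R -> R) (S' : {pred R'}) (lam' : nat -> R' -> R')
    (f : R -> R') : Prop :=
  ring_hom_on S S' f /\ forall n, {in S, forall x, f (lam n x) = lam' n (f x)}.

Definition lambda_subring (R : comNzRingType) (S : {pred R})
    (lam : nat -> R -> R) (G : {pred R}) : Prop :=
  [/\ {subset G <= S}, subring_closed G &
      forall n, {in G, forall x, lam n x \in G}].

(* Coefficient of t^n in                                                      *)
(*   d/dt lambda_t(x) = lambda_t(x) * sum_(n >= 0) (-1)^n Psi^(n+1)(x) t^n.   *)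
(* Since lambda^0(x) = 1, this determines every Psi^n(x), n >= 1.             *)
Definition adams_on (R : comNzRingType) (S : {pred R})
    (lam Psi : nat -> R -> R) : Prop :=
  {in S, forall x n, lam n.+1 x *+ n.+1 =
    \sum_(i < n.+1) lam (n - i)%N x * ((-1) ^+ i * Psi i.+1 x)}.

End Lambda.

Definition is_theta (theta : psring -> psring) : Prop :=
  ring_hom_on QSym PQSym theta /\
  forall al, composition al -> theta (qsF al) = peakK (peaks al).

Definition peakL (theta : psring -> psring) (al : seq nat) : psring :=
  theta (qsM al).

Definition is_Phi (theta : psring -> psring) (n : nat) (g : psring -> psring) : Prop :=
  ring_hom_on PQSym PQSym g /\
  forall al, odd_composition al ->
    g (peakL theta al) = if odd n then peakL theta (scale_comp n al) else 0.

(* Main.v *)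
(* The key is a formula for theta on the monomial basis: writing M_alpha as     *)

(* The formula for [theta] is [theta_qsM], with coefficients [theta_coef]: [peakK_bcomp] computes
   the coefficients of the peak functions, and [covered_sum_theta_coef] evaluates the resulting
   alternating sum. From it come [theta_frob], the compatibility with Adams operations, and
   [theta_qsM_odd], which yields the uniqueness [is_Phi_uniq]. The descent rests on [theta_newton],
   [theta_lamQ_wd] and [lambda_ring_quotient]; the statement on [Gamma] rests on [elem_newton],
   [theta_elem] and [lambda_subring_generated]. *)
(* an alternating sum of the F_beta over the refinements beta of alpha, and     *)
(* using that the coefficient of M_D in K_P is 2^(|D|+1) if P is contained in   *)
(* D u (D+1) and 0 otherwise, one finds that theta(M_alpha) is the sum of       *)
(* (-1)^e 2^k M_(|alpha^1|, ..., |alpha^k|) over the factorizations of alpha    *)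
(* into k consecutive blocks whose last parts are odd, e being the number of    *)
(* even parts of alpha.  This formula only sees parities and sums of parts.     *)
(* Hence for odd n, theta commutes with the Frobenius endomorphism              *)
(* x_i |-> x_i^n, whose restriction to QSym is Psi^n; for even n, theta o Psi^n *)
(* only retains the constant term.  Merging an even part with its successor     *)
(* changes theta(M_alpha) by a sign, so the L_alpha with odd parts span.        *)
(*   Since power series are torsion-free, Newton's recursion shows that         *)
(* theta(lambda^n f) depends only on theta(f), so the lambda-structure descends *)
(* along theta.  Finally lambda^n(q_1) = theta(e_n) = q_n, so Gamma is the      *)
(* subring generated by the lambda^n(q_1), and such a subring is stable by the  *)
(* lambda-ring axioms.                                                          *)
Require Import Defs.
From HB Require Import structures.
From mathcomp Require Import all_boot all_order all_algebra finmap.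
From mathcomp Require Import boolp classical_sets functions fsbigop.
From mathcomp Require Import monalg mpoly zify ring.

Set Implicit Arguments.
Unset Strict Implicit.
Unset Printing Implicit Defensive.

Import GRing.Theory Num.Theory.
Local Open Scope ring_scope.

Implicit Types (m : {cmonom nat}).

(** * Compositions as bit sequences *)

(* The bits of u are the indicator of D(alpha) in [n-1], where n = (size u).+1; *)
(* every composition of n arises from exactly one u.                           *)
Fixpoint bcomp (u : bitseq) : seq nat :=
  if u is b :: u' then
    if b then 1%N :: bcomp u'
    else (head 0%N (bcomp u')).+1 :: behead (bcomp u')
  else [:: 1%N].

Lemma bcompP u : exists a s, bcomp u = a.+1 :: s.
Proof. by case: u => [|[] u] /=; do 2 eexists. Qed.

Lemma bcomp_composition u : composition (bcomp u).
Proof.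
elim: u => [//|b u]; have [a [s E]] := bcompP u.
by rewrite /= E /composition; case: b.
Qed.

Lemma sumn_bcomp u : sumn (bcomp u) = (size u).+1.
Proof.
elim: u => [//|b u]; have [a [s E]] := bcompP u.
by rewrite /= E /=; case: b => /= <-; lia.
Qed.

Lemma bcomp_inj u v : bcomp u = bcomp v -> u = v.
Proof.
elim: u v => [|b u IH] [|c v] //=.
- by have [a [s ->]] := bcompP v; case: c.
- by have [a [s ->]] := bcompP u; case: b.
have [a [s E]] := bcompP u; have [a' [s' E']] := bcompP v.
by move: (IH v); rewrite E E'; case: b; case: c => //= H [] *;
  congr (_ :: _); apply: H; congruence.
Qed.

Lemma bcomp_surj al : composition al -> exists u, al = bcomp u.
Proof.
case/andP; elim: al => // a al IH _ /andP[a1 pal].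
have [u E] : exists u, 1%N :: al = bcomp u.
  case: al IH pal => [|b al] IH pal; first by exists [::].
  by have [||u E] := IH; rewrite ?pal //; exists (true :: u); rewrite /= -E.
elim: a a1 => // -[|a] IHa _; first by exists u.
by have [//|v Ev] := IHa; exists (false :: v); rewrite /= -Ev.
Qed.

Lemma all_bcomp u : all (leq 1) (bcomp u).
Proof. by case/andP: (bcomp_composition u). Qed.

Lemma mem_Dset_cons a al k : all (leq 1) al ->
  (k \in Dset (a :: al)) = (al != [::]) &&
     ((k == a) || (a < k)%N && ((k - a)%N \in Dset al)).
Proof.
case: al => [//|b al] /andP[b0 _]; rewrite /Dset [iota _ _]/= [map _ _]/= addn0 inE.
congr (_ || _); rewrite -[2%N]/(1 + 1)%N (iotaDl 1) -map_comp.
apply/mapP/andP => [[i ii ->]|[ak]].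
  have i0 : (0 < i)%N by move: ii; rewrite mem_iota => /andP[].
  case: i i0 ii => // i _ ii.
  rewrite /= ; split; first by rewrite -addn1 leq_add2l addn_gt0 b0.
  rewrite addKn; apply: (map_f (fun k => sumn (take k (b :: al)))) ii.
case/mapP=> i ii ki; exists i => //=.
by rewrite -ki subnKC // ltnW.
Qed.

Lemma Dset_bcomp u k : (k \in Dset (bcomp u)) = (0 < k)%N && nth false u k.-1.
Proof.
elim: u k => [|b u IH] k /=; first by rewrite nth_nil andbF.
move: (IH) (all_bcomp u); have [a [s E]] := bcompP u.
rewrite E => {}IH /andP[_ sp].
case: b; rewrite mem_Dset_cons //=.
  case: k => [|[|k]] //=; rewrite subn1 /=; exact: IH.
by move: (IH k.-1); rewrite mem_Dset_cons //; case: k => [|[|k]].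
Qed.

(** Inclusion of the coded subsets of [n-1]; equivalently, [bcomp D] refines [bcomp t]. *)
Fixpoint bits_le (t D : bitseq) : bool :=
  match t, D with
  | [::], [::] => true
  | b :: t', d :: D' => (b ==> d) && bits_le t' D'
  | _, _ => false
  end.

Lemma bits_le_size t D : bits_le t D -> size t = size D.
Proof. by elim: t D => [|b t IH] [|d D] //= /andP[_ /IH->]. Qed.

Lemma bits_leP t D : size t = size D ->
  reflect (forall k, nth false t k -> nth false D k) (bits_le t D).
Proof.
elim: t D => [|b t IH] [|d D] //=; first by constructor=> k; rewrite nth_nil.
move=> [/IH{}IH]; apply: (iffP andP) => [[bd /IH h] [|k] //=|h].
- exact/implyP.
- exact: h.
- by split; [apply/implyP/(h 0%N)|apply/IH => k; apply: (h k.+1)].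
Qed.

Fixpoint refinements (t : bitseq) : seq bitseq :=
  if t is b :: t' then
    if b then [seq true :: v | v <- refinements t']
    else [seq false :: v | v <- refinements t'] ++ [seq true :: v | v <- refinements t']
  else [:: [::]].

Lemma refinements_sum t D :
  \sum_(v <- refinements t) (v == D)%:R = (bits_le t D)%:R :> int.
Proof.
elim: t D => [|b t IH] [|d D] /=; rewrite ?big_seq1 //.
  by case: b; rewrite ?big_cat ?big_map /= !big1.
have e c : \sum_(v <- refinements t) (c :: v == d :: D)%:R =
    ((c == d) && bits_le t D)%:R :> int.
  under eq_bigr do rewrite eqseq_cons.
  by case: (c == d) => /=; rewrite ?IH // big1.
by case: b; rewrite ?big_cat !big_map /= !e; case: (d) => /=; case: bits_le.
Qed.

(** The signs are the values of the Moebius function of the Boolean lattice; they express M through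
    the F. *)
Fixpoint signed_refs (t : bitseq) : seq (int * bitseq) :=
  if t is b :: t' then
    if b then [seq (p.1, true :: p.2) | p <- signed_refs t']
    else [seq (p.1, false :: p.2) | p <- signed_refs t'] ++
         [seq (- p.1, true :: p.2) | p <- signed_refs t']
  else [:: (1, [::])].

Lemma signed_refs_size t p : p \in signed_refs t -> size p.2 = size t.
Proof.
elim: t p => [|b t IH] p /=; first by rewrite inE => /eqP->.
by case: b; rewrite ?mem_cat; [|case/orP] => /mapP[q /IH qs ->] /=; rewrite qs.
Qed.

(** Moebius inversion: at a position of [D] outside [t] the two choices cancel, so that only [D = t]
    survives. *)
Lemma signed_refs_bits_le t D :
  \sum_(p <- signed_refs t) p.1 * (bits_le p.2 D)%:R = (t == D)%:R :> int.
Proof.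
elim: t D => [|b t IH] [|d D] /=; rewrite ?big_seq1 ?mulr0 ?mulr1 //.
  by case: b; rewrite ?big_cat ?big_map /= !big1 ?addr0 // => p _; rewrite mulr0.
rewrite eqseq_cons; case: b; rewrite ?big_cat !big_map /=.
  by case: d => /=; rewrite ?IH //= big1 // => p _; rewrite mulr0.
case: d => /=; rewrite ?IH //=.
  by under eq_bigr do rewrite mulNr; rewrite sumrN IH subrr.
by rewrite [X in _ + X]big1 ?addr0 // => p _ ; rewrite mulr0.
Qed.

(* Every peak i of t satisfies i \in D or i-1 \in D; fr tells whether the    *)
(* position before the first bit lies in t or in D.                           *)
Fixpoint peaks_covered (fr : bool) (t D : bitseq) : bool :=
  match t, D with
  | b :: t', d :: D' => (b ==> (fr || d)) && peaks_covered (b || d) t' D'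
  | _, _ => true
  end.

(** With [fr = true] this is, up to a power of 2, the coefficient of M_D in theta (M_t): position 1
    is never a peak, so nothing has to cover it. *)
Definition covered_sum fr t D : int :=
  \sum_(p <- signed_refs t) p.1 * (peaks_covered fr p.2 D)%:R.

(* theta (M_al) = \sum_de 2 ^ size de * theta_coef al de * M_de.  The          *)
(* coefficient vanishes unless al is a concatenation of blocks summing to the *)
(* parts of de, each ending in an odd part; it is then (-1) to the number of  *)
(* even parts of al.                                                          *)
Fixpoint theta_coef (al de : seq nat) : int :=
  match al, de with
  | [::], [::] => 1
  | a :: al', d :: de' =>
      if d == a then (odd a)%:R * theta_coef al' de'
      else if (a < d)%N then (-1) ^+ a.-1 * theta_coef al' ((d - a)%N :: de') else 0
  | _, _ => 0
  end.

(* The value of the same sum when the previous position lies neither in t nor *)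
(* in D, so that no element of t may come before the next element of D.       *)
Definition theta_coef_blocked (al de : seq nat) : int :=
  match al, de with
  | a :: al', d :: de' => if d == a then theta_coef al' de' else 0
  | _, _ => 0
  end.

Lemma covered_sum_cons fr a t d D :
  covered_sum fr (a :: t) (d :: D) =
    (if a then 0 else covered_sum d t D) +
    (if a then 1 else -1) * (fr || d)%:R * covered_sum true t D.
Proof.
rewrite /covered_sum /=; case: a; rewrite ?big_cat !big_map /=; rewrite ?add0r.
  case: (fr || d) => /=; first by rewrite !mul1r.
  by rewrite mulr0 mul0r big1 // => p _; rewrite mulr0.
congr (_ + _); rewrite mulr_sumr; apply: eq_bigr => p _ /=.
by case: (fr || d) => /=; rewrite ?mulr0 ?mul0r ?mulr1 ?mulN1r ?mulNr.
Qed.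

(** A position in [D] but not in [t] contributes two cancelling choices. A position in neither
    leaves, for [fr = true], the blocked sum minus the free one. If the leading parts are equal,
    this exchanges the parities of that part; if the part of [t] is smaller, it flips the sign. *)
Lemma covered_sum_theta_coef t D : size t = size D ->
  covered_sum true t D = theta_coef (bcomp t) (bcomp D) /\
  covered_sum false t D = theta_coef_blocked (bcomp t) (bcomp D).
Proof.
elim: t D => [|a t IH] [|d D] //=.
  by rewrite /covered_sum /= !big_seq1 /= !mul1r.
case=> /IH[]; have [x [s Ex]] := bcompP t; have [y [s' Ey]] := bcompP D.
rewrite Ex Ey !covered_sum_cons => H1 H0.
case: a; case: d; rewrite /= ?H1 ?H0 /= ?eqxx ?subSS ?subn0 ?eqSS ?ltnS;
  rewrite ?mul1r ?mulr1 ?mul0r ?mulr0 ?add0r ?addr0 ?addrN.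
1, 2: by split.
- by split=> //; rewrite mulN1r subrr.
- split=> //; case: (ltngtP x y) => /= _.
  + by rewrite add0r exprS mulrA.
  + by rewrite mulr0 addr0.
  + by rewrite negbK; case: (odd x); rewrite /= ?mul0r ?mulr0 ?mul1r ?mulN1r ?subrr ?addr0.
Qed.

Lemma theta_coef_sumn al de : sumn al != sumn de -> theta_coef al de = 0.
Proof.
elim: al de => [|a al IH] [|d de] //=.
case: ltngtP => // [ad|->] h; last by rewrite IH ?mulr0 //; lia.
by rewrite IH ?mulr0 //=; lia.
Qed.

(** Each block must end in an odd part, and all parts of [scale_comp n al] are even. *)
Lemma theta_coef_even n al de : ~~ odd n -> al != [::] ->
  theta_coef (scale_comp n al) de = 0.
Proof.
move=> en; elim: al de => [|a al IH] [|d de] //= _.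
rewrite oddM (negPf en) mul0r.
case: eqP => // _; case: ifP => // _.
case: al IH => [|b al] IH; first by rewrite mulr0.
by rewrite IH ?mulr0.
Qed.

(** The recursion only compares sums of parts and reads parities; multiplication by an odd number
    preserves both. *)
Lemma theta_coef_scale n al de : odd n -> all (leq 1) al ->
  theta_coef (scale_comp n al) (scale_comp n de) = theta_coef al de.
Proof.
move=> on; have n0 : (0 < n)%N by case: n on.
elim: al de => [|a al IH] [|d de] //= /andP[a0 pal].
rewrite eqn_pmul2l // ltn_pmul2l // oddM on /= IH //.
rewrite -mulnBr (IH ((d - a)%N :: de)) //.
do 2! congr (if _ then _ else _ ); congr (_ * _).
rewrite -signr_odd -[in RHS]signr_odd; congr ((-1) ^+ nat_of_bool _).
have na0 : (0 < n * a)%N by rewrite muln_gt0 n0.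
by move: (oddM n a); rewrite on -(prednK na0) -{2}(prednK a0) /= => /negb_inj.
Qed.

(** For a nonzero coefficient each part of [de] is a sum of parts of [scale_comp n al], hence a
    multiple of [n]. *)
Lemma theta_coef_ndvd n al de : ~~ all (dvdn n) de -> theta_coef (scale_comp n al) de = 0.
Proof.
elim: al de => [|a al IH] [|d de] //=.
case: ltngtP => // [ad|E] h; last first.
  by rewrite IH ?mulr0 //; move: h; rewrite -E dvdn_mulr.
rewrite IH ?mulr0 //=; apply: contra h => /andP[h ->].
by rewrite andbT -(subnK (ltnW ad)) dvdn_add ?dvdn_mulr.
Qed.

(** An even part cannot end a block, so it shares the block of its successor. Merging them keeps the
    parity of [b] and loses one even part, whence the sign. *)
Lemma theta_coef_merge a b al de : ~~ odd a -> (0 < a)%N -> (0 < b)%N ->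
  theta_coef (a :: b :: al) de = - theta_coef ((a + b)%N :: al) de.
Proof.
move=> ea a0 b0; case: de => [|d de] /=; first by rewrite oppr0.
have eNa : (-1) ^+ a.-1 = -1 :> int.
  by rewrite -signr_odd; case: a a0 ea => //= a _; rewrite negbK => ->.
have eNab : (-1) ^+ (a + b).-1 = (-1) ^+ b.-1 :> int.
  by have -> : ((a + b).-1 = (a.-1 + b.-1).+1)%N; [lia|rewrite exprS exprD eNa; ring].
rewrite eNa eNab (negPf ea) mul0r oddD (negPf ea) /=.
case: (ltngtP d a) => [da|ad|->].
- by rewrite !ifN ?oppr0 // -?leqNgt; lia.
- have -> : (d - a == b)%N = (d == a + b)%N by lia.
  have -> : (b < d - a)%N = (a + b < d)%N by lia.
  rewrite subnDA mulN1r; by case: eqP => // _; case: ifP.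
- by rewrite !ifN ?oppr0 // -?leqNgt; lia.
Qed.

Lemma theta_coef_odd al : composition al ->
  exists2 p : int * seq nat, odd_composition p.2 &
    forall de, theta_coef al de = p.1 * theta_coef p.2 de.
Proof.
case/andP; elim: al => // a al IH _ /andP[a0 pal].
have [oa|ea] := boolP (odd a).
  case: (eqVneq al [::]) => [->|nal].
    by exists (1, [:: a]) => [|de]; rewrite ?mul1r // /odd_composition /composition /= a0 oa.
  have [//|//|[e be] ob h] := IH; exists (e, a :: be).
    by move: ob; rewrite /odd_composition /composition /= a0 oa => /andP[/andP[_ ->]].
  case=> [|d de] /=; first by rewrite mulr0.
  by rewrite !h /=; case: eqP => // _; [|case: ifP => // _]; rewrite ?mulr0 // mulrCA.
case: (eqVneq al [::]) => [->|nal].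
  (* An even last part cannot end a block, so all coefficients vanish; with the factor 0 any odd
     composition serves as witness. *)
  exists (0, [:: 1%N]) => // -[|d de] //=; rewrite mul0r (negPf ea) mul0r.
  by case: eqP => // _; case: ifP => // _; rewrite mulr0.
have [//|//|[e [//|b be]] ob h] := IH.
have b0 : (0 < b)%N by case/andP: ob => /andP[_ /andP[]].
exists (- e, (a + b)%N :: be).
  move: ob; rewrite /odd_composition /composition /= oddD (negPf ea) addn_gt0 a0 /=.
  by case/andP => /andP[_ ->] ->.
move=> de; transitivity (e * theta_coef (a :: b :: be) de); last first.
  by rewrite theta_coef_merge // mulrN mulNr.
case: de => [|d de] /=; first by rewrite mulr0.
by rewrite !h /=; case: eqP => // _; [|case: ifP => // _]; rewrite ?mulr0 // mulrCA.
Qed.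

(** All parts are odd, so each composition of [n] arises from exactly one division into blocks, with
    sign 1. *)
Lemma theta_coef_nseq1 n de : all (leq 1) de ->
  theta_coef (nseq n 1%N) de = (n == sumn de)%:R.
Proof.
elim: n de => [|n IH] [|d de] //= /andP[d0 pde].
  by rewrite eq_sym addn_eq0 eqn0Ngt d0.
by case: d d0 => // -[|d] _ /=; rewrite mul1r IH //= ?subn1.
Qed.

Fixpoint coarsenings (D : bitseq) : seq bitseq :=
  if D is d :: D' then
    if d then [seq false :: v | v <- coarsenings D'] ++ [seq true :: v | v <- coarsenings D']
    else [seq false :: v | v <- coarsenings D']
  else [:: [::]].

Lemma mem_coarsenings D t : (t \in coarsenings D) = bits_le t D.
Proof.
elim: D t => [|d D IH] [|b t] //=.
  by case: d; rewrite ?mem_cat; apply/negP; [case/orP|] => /mapP[].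
have e c : (b :: t \in [seq c :: v | v <- coarsenings D]) = (b == c) && bits_le t D.
  apply/mapP/andP => [[v vD [-> ->]]|[/eqP-> tD]]; last by exists t; rewrite ?IH.
  by rewrite eqxx -IH.
by case: d; rewrite ?mem_cat !e; case: (b) => //=; rewrite ?orbF.
Qed.

Lemma coarsenings_uniq D : uniq (coarsenings D).
Proof.
elim: D => [//|d D IH] /=.
have inj c : injective (cons c : bitseq -> bitseq) by move=> u v [].
case: d; rewrite ?cat_uniq !map_inj_uniq ?IH //= andbT.
by apply/hasPn => _ /mapP[v _ ->]; apply/mapP => -[].
Qed.

(* In the next two definitions position i is constrained when p holds at i, and *)
(* prev is the value at position i-1.                                           *)
Fixpoint xor_at (prev : bool) (p t : bitseq) : bool :=
  match p, t with
  | x :: p', b :: t' => (x ==> (prev (+) b)) && xor_at b p' t'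
  | _, _ => true
  end.

Fixpoint or_at (prev : bool) (p t : bitseq) : bool :=
  match p, t with
  | x :: p', b :: t' => (x ==> (prev || b)) && or_at b p' t'
  | _, _ => true
  end.

Fixpoint sparse (p : bitseq) : bool :=
  if p is x :: p' then (x ==> ~~ head false p') && sparse p' else true.

Lemma or_at_head b b' p D : ~~ head false p -> or_at b p D = or_at b' p D.
Proof. by case: p D => [|[] p] [|d D]. Qed.

(* Distinct peaks i, j are not adjacent, so the constraints on the pairs        *)
(* {i-1, i} and {j-1, j} are independent: a pair with one or two elements in D  *)
(* admits one or two choices out of two or four.                               *)
Lemma xor_at_count prev p D : size p = size D -> sparse p -> ~~ head false p ->
  (2 ^ count id p * count (xor_at prev p) (coarsenings D))%N =
  (or_at prev p D * 2 ^ count id D)%N.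
Proof.
have [n] := ubnP (size p); elim: n => // n IH in prev p D *.
case: p => [|[] p] //; case: D => [|d D] //=.
rewrite ltnS => pn [] szp sp _.
case: p pn szp sp => [|[] p] pn szp sp.
- by case: D szp => // _; case: d.
(* The second position is constrained, so the first two are treated together; by sparsity the
   remainder starts unconstrained. *)
- case: D szp => // d2 D [szp]; case/andP: sp => hp sp.
  have {}IH prev' := IH prev' p D (ltnW pn) szp sp hp.
  have eta (f : pred bitseq) s : count [pred x | f x] s = count f s by [].
  case: d; case: d2; rewrite /= ?map_cat ?count_cat ?count_map /preim /=;
    move: (IH true) (IH false); rewrite ?expnS ?count_pred0 ?eta;
    rewrite (or_at_head true false) // -?/xor_at ?add0n; lia.
- have {}IH prev' := IH prev' (false :: p) D pn szp sp isT.
  have eta (f : pred bitseq) s : count [pred x | f x] s = count f s by [].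
  move: (IH true) (IH false); rewrite add0n; set q := false :: p.
  rewrite (@or_at_head true false q) //.
  by case: d; rewrite ?count_cat !count_map /preim /= ?eta ?expnS ?add0n;
    rewrite ?(@or_at_head true false q) //; lia.
Qed.


(** * Coefficients of M, F and K *)

Definition mvars m : seq nat := sort leq (finsupp m).

(** The composition read off a monomial; the coefficients at [m] of M, F and K depend on [m] only
    through it. *)
Definition mexp m : seq nat := [seq m i | i <- mvars m].

Lemma mem_mvars m j : (j \in mvars m) = (m j != 0)%N.
Proof. by rewrite mem_sort cmE_neq0. Qed.

Lemma mvars_sorted m : sorted ltn (mvars m).
Proof.
rewrite ltn_sorted_uniq_leq sort_uniq fset_uniq /=.
exact: (sort_sorted leq_total).
Qed.

Lemma mvars_uniq m : uniq (mvars m).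
Proof. by rewrite sort_uniq fset_uniq. Qed.

Lemma mexp_gt0 m : all (leq 1) (mexp m).
Proof. by apply/allP => _ /mapP[j jm ->]; rewrite lt0n -mem_mvars. Qed.

Lemma sumn_mexp m : sumn (mexp m) = monalg.mdeg m.
Proof.
rewrite sumnE big_map monalg.mdegE; apply: perm_big.
by rewrite perm_sort.
Qed.

Lemma mexp_composition m : m != mone -> composition (mexp m).
Proof.
move=> m1; rewrite /composition mexp_gt0 andbT; apply: contraNneq m1 => E.
by rewrite -monalg.mdeg_eq0 -sumn_mexp E.
Qed.

Lemma mexp1 : mexp mone = [::].
Proof. by rewrite /mexp /mvars mdom1. Qed.

Lemma expcmnE m k j : expcmn m k j = (k * m j)%N.
Proof.
rewrite /expcmn; elim: k => [|[|k] IH]; rewrite ?mul1n ?cm1 //.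
by rewrite iteropS in IH; rewrite iteropS mulSn -IH; exact: (cmM j m _).
Qed.

Lemma monomialE i al j :
  monomial i al j = (\sum_(p <- zip i al) (p.1 == j) * p.2)%N.
Proof.
rewrite /monomial; elim: (zip i al) => [|p s IH]; first by rewrite !big_nil cm1.
by rewrite !big_cons cmM IH expcmnE cmU mulnC.
Qed.

Lemma monomial_nth i al j : uniq i -> size i = size al ->
  monomial i al j = nth 0%N al (index j i).
Proof.
rewrite monomialE; elim: i al => [|x i IH] [|a al] //=; first by rewrite big_nil.
case/andP=> xi ui [sz]; rewrite big_cons IH //= eq_sym.
case: eqP => [->|_] /=; last by rewrite mul0n.
by rewrite mul1n nth_default ?addn0 // -sz memNindex.
Qed.

Lemma mvars_monomial i al : sorted ltn i -> size i = size al ->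
  all (leq 1) al -> mvars (monomial i al) = i.
Proof.
move=> si sz pal; have ui : uniq i by apply: sorted_uniq si; [exact: ltn_trans|exact: ltnn].
apply: (irr_sorted_eq ltn_trans ltnn) => [|//|j]; first exact: mvars_sorted.
rewrite mem_mvars monomial_nth // -index_mem sz.
case: ltnP => [h|h]; last by rewrite nth_default.
by rewrite -lt0n; apply: (allP pal); apply: mem_nth.
Qed.

Lemma mexp_monomial i al : sorted ltn i -> size i = size al ->
  all (leq 1) al -> mexp (monomial i al) = al.
Proof.
move=> si sz pal; have ui : uniq i by apply: sorted_uniq si; [exact: ltn_trans|exact: ltnn].
rewrite /mexp mvars_monomial //; apply: (@eq_from_nth _ 0%N); rewrite size_map // => k ki.
by rewrite (nth_map 0%N) // monomial_nth // index_uniq.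
Qed.

Lemma monomial_mexp m : monomial (mvars m) (mexp m) = m.
Proof.
apply/eqP/cmP => j; rewrite monomial_nth ?mvars_uniq ?size_map //.
have [jm|jm] := boolP (j \in mvars m).
  by rewrite (nth_map 0%N) ?index_mem // nth_index.
rewrite nth_default ?size_map ?memNindex //.
by move: jm; rewrite mem_mvars negbK => /eqP.
Qed.

Lemma ps_sumE (S : set {cmonom nat}) m (b : bool) : (S m <-> b) -> ps_sum S m = b%:R.
Proof.
move=> h; rewrite /ps_sum; congr (nat_of_bool _)%:R.
apply/idP/idP => [|bt]; first by rewrite inE => /h.
by rewrite inE; apply/h.
Qed.

Lemma qsME al m : all (leq 1) al -> qsM al m = (mexp m == al)%:R.
Proof.
move=> pal; apply: ps_sumE; split => [[i [sz si] <-]|/eqP<-].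
  by rewrite mexp_monomial.
exists (mvars m); last exact: monomial_mexp.
by rewrite size_map; split=> //; exact: mvars_sorted.
Qed.

(* The word x_(i_1) ... x_(i_1) x_(i_2) ... with multiplicities al. *)
Definition run (i al : seq nat) : seq nat :=
  flatten [seq nseq p.2 p.1 | p <- zip i al].

Definition word m : seq nat := run (mvars m) (mexp m).

Definition ascents (s : seq nat) : bitseq :=
  if s is x :: s' then pairmap ltn x s' else [::].

(** The letter [x] that precedes the word belongs to the first run, whence [a.+1]. *)
Lemma bcomp_ascents_run x i a al : path ltn x i -> size i = size al ->
  all (leq 1) al -> bcomp (pairmap ltn x (nseq a x ++ run i al)) = a.+1 :: al.
Proof.
elim: i al x a => [|y i IH] [|b al] //= x a.
  move=> _ _ _; rewrite cats0; elim: a => //= a IHa.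
  by rewrite ltnn IHa.
case/andP=> xy pi [sz] /andP[b0 pal]; elim: a => [|a IHa] /=.
  by rewrite /run /=; case: b b0 => //= b _; rewrite xy /= IH.
by rewrite ltnn IHa.
Qed.

Lemma bcomp_ascents_word m : m != mone -> bcomp (ascents (word m)) = mexp m.
Proof.
move/mexp_composition; rewrite /word; move: (mvars_sorted m) (size_map m (mvars m)).
rewrite -/(mexp m); case: (mvars m) (mexp m) => [|x i] [|[|a] al] //= pi [sz].
by case/andP=> _ /andP[_ pal]; apply: bcomp_ascents_run.
Qed.

Lemma size_run i al : size i = size al -> size (run i al) = sumn al.
Proof.
elim: i al => [|x i IH] [|a al] //= [sz].
by rewrite size_cat size_nseq IH.
Qed.

Lemma run_sorted i al : sorted ltn i -> size i = size al -> sorted leq (run i al).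
Proof.
move=> si; have : sorted leq i by apply: sub_sorted si => ? ?; exact: ltnW.
elim: i al {si} => [|x i IH] [|a al] //= pi [sz].
rewrite (sorted_pairwise leq_trans) pairwise_cat -!(sorted_pairwise leq_trans).
rewrite -/(run i al) IH ?(path_sorted pi) // andbT.
have allx : all (leq x) (run i al).
  apply/allP => z /flattenP[_ /mapP[[u v] uv ->]] /nseqP[-> _].
  have ui : u \in i by move: uv => /(map_f fst); rewrite -/unzip1 unzip1_zip ?sz.
  by move/(order_path_min leq_trans)/allP: pi; apply.
apply/andP; split.
  by apply/allrelP => y z /nseqP[-> _] /(allP allx).
by case: a {sz} => // a; elim: a => //= a ->; rewrite leqnn.
Qed.

Lemma monomial1E s j : monomial s (nseq (size s) 1%N) j = count_mem j s.
Proof.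
rewrite monomialE; elim: s => [|x s IH]; first by rewrite big_nil.
by rewrite /= big_cons IH muln1.
Qed.

Lemma count_run i al j : size i = size al -> count_mem j (run i al) = monomial i al j.
Proof.
rewrite monomialE; elim: i al => [|x i IH] [|a al] //=; first by rewrite big_nil.
by move=> [sz]; rewrite big_cons /run /= count_cat count_nseq -/(run i al) IH.
Qed.

Lemma monomial_word m : monomial (word m) (nseq (size (word m)) 1%N) = m.
Proof.
apply/eqP/cmP => j; rewrite monomial1E count_run ?size_map //.
by rewrite monomial_mexp.
Qed.

(** A weakly increasing sequence is determined by its multiplicities, which are the exponents of its
    monomial. *)
Lemma word_uniq s m : sorted leq s -> monomial s (nseq (size s) 1%N) = m -> s = word m.
Proof.
move=> ss E; apply: (sorted_eq leq_trans anti_leq) => //.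
  by rewrite run_sorted ?mvars_sorted ?size_map.
apply/allP => j _ /=; rewrite -!monomial1E monomial_word E //.
Qed.

Lemma qsF1 u : qsF (bcomp u) mone = 0.
Proof.
apply: (@ps_sumE _ _ false); split => // -[i [sz _ _] E].
case: i sz E => [|x i] sz E; first by rewrite sumn_bcomp in sz.
by have := monomial1E (x :: i) x; rewrite E cm1 /= eqxx.
Qed.

(** [word m] is the only candidate for the index sequence, and [D] marks its strict ascents; these
    must include the ones that [u] imposes. *)
Lemma qsFE u D m : bcomp D = mexp m -> qsF (bcomp u) m = (bits_le u D)%:R.
Proof.
move=> ED; have m1 : m != mone.
  by apply/eqP => E; have [a [s]] := bcompP D; rewrite ED E mexp1.
have {}ED : D = ascents (word m) by apply: bcomp_inj; rewrite bcomp_ascents_word.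
have szw : size (word m) = (size D).+1.
  by rewrite size_run ?size_map // -(bcomp_ascents_word m1) -ED sumn_bcomp.
have nD k : nth false D k = (k < size D)%N && (nth 0%N (word m) k < nth 0%N (word m) k.+1)%N.
  move: szw ED; case: (word m) => // x s [szs] /= ED.
  have [kD|kD] := ltnP k (size D); last by rewrite nth_default.
  rewrite ED (nth_pairmap 0%N) ?szs //=.
apply: ps_sumE; split => [[i [sz si hi] E]|uD].
  move: sz hi; rewrite (word_uniq si E) szw sumn_bcomp => -[szD] hi.
  apply/bits_leP => // k uk; rewrite nD szD.
  have ks : (k < size u)%N by case: ltnP uk => // ?; rewrite nth_default.
  by rewrite ks; apply: (hi k.+1); rewrite Dset_bcomp.
exists (word m); last exact: monomial_word.
split; first by rewrite szw sumn_bcomp (bits_le_size uD).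
  by rewrite run_sorted ?mvars_sorted ?size_map.
move=> k; rewrite Dset_bcomp => /andP[k0 uk].
move/bits_leP: (uD) => /(_ (bits_le_size uD) _ uk); rewrite nD => /andP[_].
by rewrite prednK.
Qed.

Lemma ps_sumf (I : Type) (r : seq I) (P : pred I) (F : I -> psring) m :
  (\sum_(i <- r | P i) F i) m = \sum_(i <- r | P i) F i m.
Proof. exact: (big_morph (fun f : psring => f m)). Qed.

Lemma ps_muln (f : psring) k m : (f *+ k) m = f m *+ k.
Proof. by elim: k => // k IH; rewrite !mulrS -IH. Qed.

Lemma ps_mulz (f : psring) (z : int) m : (f *~ z) m = f m * z.
Proof.
rewrite -mulrzz; case: z => k; first exact: ps_muln.
by rewrite NegzE !mulrNz; congr (- _); exact: (ps_muln f k.+1).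
Qed.

(** Indicator of the peak set, [prev] being the preceding bit; the initial value [true] keeps
    position 1 from being a peak. *)
Fixpoint peakbits (prev : bool) (u : bitseq) : bitseq :=
  if u is b :: u' then (b && ~~ prev) :: peakbits b u' else [::].

Lemma size_peakbits prev u : size (peakbits prev u) = size u.
Proof. by elim: u prev => //= b u IH prev; rewrite IH. Qed.

Lemma nth_peakbits prev u k :
  nth false (peakbits prev u) k = nth false u k && ~~ nth false (prev :: u) k.
Proof.
by elim: u prev k => [|b u IH] prev [|k] /=.
Qed.

Lemma peakbits_sparse prev u : sparse (peakbits prev u).
Proof.
elim: u prev => //= b u IH prev; rewrite IH andbT.
by case: u {IH} => [|c u] /=; case: b; case: prev => //; case: c.
Qed.

(** Asking a position of [u] whose predecessor is outside [u] to be covered amounts to asking each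
    position of [u] to lie in [D] or to have its predecessor in [u] or [D]. *)
Lemma or_at_peakbits b d u D : or_at d (peakbits b u) D = peaks_covered (b || d) u D.
Proof.
elim: u b d D => [|b' u IH] b d [|d' D] //=.
by rewrite IH; case: b'; case: b.
Qed.

Lemma xor_atP prev p t : size p = size t ->
  reflect (forall k, nth false p k -> nth false (prev :: t) k (+) nth false t k)
          (xor_at prev p t).
Proof.
elim: p prev t => [|x p IH] prev [|b t] //=.
  by constructor=> k; rewrite nth_nil.
move=> [/(IH b){}IH]; apply: (iffP andP) => [[xb /IH h] [|k] //=|h].
- exact/implyP.
- exact: h.
- by split; [apply/implyP/(h 0%N)|apply/IH => k; apply: (h k.+1)].
Qed.

Lemma mem_peaks u (i : 'I_(sumn (bcomp u))) :
  (i \in peaks (bcomp u)) = (0 < i)%N && nth false (peakbits true u) i.-1.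
Proof.
rewrite inE !Dset_bcomp nth_peakbits; case: (i : nat) => [|[|k]] //=.
by rewrite andbF.
Qed.

Lemma card_peaks u : #|peaks (bcomp u)| = count id (peakbits true u).
Proof.
have -> : count id (peakbits true u) =
    count (fun i => (0 < i)%N && nth false (peakbits true u) i.-1)
      (iota 0 (sumn (bcomp u))).
  rewrite sumn_bcomp /= add0n (iotaDl 1) count_map.
  rewrite -[in LHS](mkseq_nth false (peakbits true u)) count_map size_peakbits.
  by apply: eq_count => k.
rewrite -val_enum_ord count_map -sum1_count big_enum_cond -sum1_card.
by apply: eq_bigl => i; rewrite mem_peaks.
Qed.

(** Membership of i in the symmetric difference of D and D + 1 says that exactly one of i-1 and i
    lies in D; the initial [false] records that 0 does not. *)
Lemma peak_index_bcomp u t : peak_index (peaks (bcomp u)) (bcomp t) =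
  (size t == size u) && xor_at false (peakbits true u) t.
Proof.
rewrite /peak_index bcomp_composition sumn_bcomp {1}sumn_bcomp eqSS /=.
case: eqP => //= szt.
have szp : size (peakbits true u) = size t by rewrite size_peakbits.
have e i : ((i \in Dset (bcomp t)) (+) (i \in [seq k.+1 | k <- Dset (bcomp t)])) =
    (0 < i)%N && (nth false (false :: t) i.-1 (+) nth false t i.-1).
  have -> : (i \in [seq k.+1 | k <- Dset (bcomp t)]) =
      (0 < i)%N && (i.-1 \in Dset (bcomp t)).
    case: i => [|i]; first by apply/mapP => -[].
    by rewrite mem_map // => ? ? [].
  by rewrite !Dset_bcomp; case: i => [|[|i]] //=; rewrite addbC.
apply/forall_inP/(xor_atP _ szp) => [h k pk|h i].
  have kn : (k.+1 < sumn (bcomp u))%N.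
    rewrite sumn_bcomp ltnS -(size_peakbits true u).
    by case: ltnP pk => // ?; rewrite nth_default.
  by have := h (Ordinal kn); rewrite mem_peaks e; apply.
by rewrite mem_peaks e => /andP[-> /h].
Qed.

Lemma size_le_sumn al : all (leq 1) al -> (size al <= sumn al)%N.
Proof. by elim: al => //= a al IH /andP[a0 /IH]; lia. Qed.

Lemma mem_le_sumn al a : a \in al -> (a <= sumn al)%N.
Proof.
by elim: al => //= b al IH; rewrite inE => /orP[/eqP->|/IH]; rewrite ?leq_addr; lia.
Qed.

Lemma size_bcomp D : size (bcomp D) = (count id D).+1.
Proof.
elim: D => //= b D; have [a [s ->]] := bcompP D.
by case: b => //= -[->].
Qed.

(** The coefficient is 2^(|P|+1) times the number of subsets of D satisfying the exclusive
    conditions at P. By [xor_at_count] this is 2^(|D|+1), or 0 if some peak is uncovered, and |D|+1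
    is the number of parts of [mexp m]. *)
Lemma peakK_bcomp u D m : bcomp D = mexp m ->
  peakK (peaks (bcomp u)) m =
    ((size u == size D) && peaks_covered true u D)%:R *+ 2 ^ size (mexp m).
Proof.
move=> ED; set P := peaks (bcomp u); set n := sumn (bcomp u) in P *.
rewrite /peakK ps_muln ps_sumf card_peaks -ED size_bcomp.
pose L := [seq map val (b : n.-bseq 'I_n.+1) | b <- enum {: n.-bseq 'I_n.+1} &
             peak_index P (map val (b : n.-bseq 'I_n.+1))].
have -> : \sum_(b : n.-bseq 'I_n.+1 | peak_index P (map val b)) qsF (map val b) m
    = \sum_(al <- L) qsF al m.
  by rewrite big_map big_filter big_enum_cond.
have LE al : al \in L -> exists2 t, al = bcomp t & 
    (size t = size u) /\ xor_at false (peakbits true u) t.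
  case/mapP=> b; rewrite mem_filter => /andP[Pb _] ->.
  move: (Pb) => /andP[/bcomp_surj[t E] _].
  by exists t => //; move: Pb; rewrite E peak_index_bcomp => /andP[/eqP].
case: (eqVneq (size u) (size D)) => /= [szu|nsz]; last first.
  rewrite mul0rn big1_seq ?mul0rn // => al /LE[t -> [szt _]].
  rewrite (qsFE _ ED); case: (boolP (bits_le t D)) => // /bits_le_size.
  by rewrite szt => /eqP; rewrite (negPf nsz).
have szp : size (peakbits true u) = size D by rewrite size_peakbits.
rewrite (bigID (fun al => qsF al m != 0)) /= [X in _ + X]big1 ?addr0; last first.
  by move=> al; rewrite negbK => /eqP.
rewrite -big_filter.
(* The nonzero terms are those indexed by subsets of [D], so the bounded sequences can be traded for
   [coarsenings D]. *)
have -> : \sum_(al <- [seq al <- L | qsF al m != 0]) qsF al m =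
    \sum_(al <- [seq bcomp t | t <- coarsenings D & xor_at false (peakbits true u) t])
      qsF al m.
  apply: perm_big; apply: uniq_perm.
  - rewrite filter_uniq // map_inj_uniq; first exact/filter_uniq/enum_uniq.
    by move=> b b' /(inj_map val_inj)/val_inj.
  - by rewrite map_inj_uniq ?filter_uniq ?coarsenings_uniq //; exact: bcomp_inj.
  move=> al; rewrite mem_filter; apply/andP/mapP => [[nz /LE[t Et [szt xt]]]|[t]].
    exists t => //; rewrite mem_filter xt mem_coarsenings /=.
    by move: nz; rewrite Et (qsFE _ ED); case: bits_le.
  rewrite mem_filter mem_coarsenings => /andP[xt tD] ->.
  rewrite (qsFE _ ED) tD; split => //.
  have nE : n = sumn (bcomp t) by rewrite /n !sumn_bcomp szu (bits_le_size tD).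
  have szb : (size [seq inord a : 'I_n.+1 | a <- bcomp t] <= n)%N.
    by rewrite size_map nE size_le_sumn ?all_bcomp.
  have vb : map val [seq inord a : 'I_n.+1 | a <- bcomp t] = bcomp t.
    rewrite -map_comp map_id_in // => a at_ /=.
    by rewrite inordK // ltnS nE mem_le_sumn.
  apply/mapP; exists (Bseq szb) => //=.
  rewrite mem_filter mem_enum andbT /= vb peak_index_bcomp xt andbT.
  by rewrite (bits_le_size tD) szu.
rewrite big_map.
set r := [seq t <- coarsenings D | xor_at false (peakbits true u) t].
have -> : \sum_(t <- r) qsF (bcomp t) m = (size r)%:R.
  rewrite -sum1_size natr_sum; apply: eq_big_seq => t.
  by rewrite mem_filter mem_coarsenings => /andP[_ tD]; rewrite (qsFE _ ED) tD.
have := xor_at_count false szp (peakbits_sparse true u).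
rewrite -(or_at_peakbits true false u D) /r size_filter.
have hh : ~~ head false (peakbits true u) by case: (u) => //= b u'; rewrite andbF.
move=> /(_ hh) H; rewrite -!mulrnA; congr (_%:R).
by rewrite !expnS mulnCA [X in (2 * X)%N]mulnC H mulnCA.
Qed.

(** * Products with powers of a variable, and Frobenius *)

Lemma ps_mul_supp (f g : psring) m (r : seq {cmonom nat}) : uniq r ->
    (forall c, c \in r -> mmul (divcm m c) c = m) ->
    (forall a c, mmul a c = m -> g c != 0 -> c \in r) ->
  (f * g) m = \sum_(c <- r) f (divcm m c) * g c.
Proof.
move=> ur hr hg.
have E : (f * g) m = \sum_(p \in [set p : {cmonom nat} * {cmonom nat} |
  mmul p.1 p.2 = m]%classic) f p.1 * g p.2 by [].
rewrite E (fsbigE [seq (divcm m c, c) | c <- r]).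
- rewrite big_map big_seq_cond [RHS]big_seq; apply: eq_bigl => c.
  case: (boolP (c \in r)) => //= cr; apply/asboolP; exact: hr.
- by rewrite map_inj_uniq // => a b [].
- by move=> _ /mapP[c cr ->]; apply: hr.
move=> [a c] /= ac nr; apply/eqP; rewrite mulf_eq0 orbC; apply: contraNT nr.
rewrite negb_or => /andP[gc _]; apply/mapP; exists c; first exact: hg ac gc.
congr (_, _); apply/eqP/cmP => i; rewrite divcmE -ac.
by rewrite (cmM i a c) addnK.
Qed.

Definition var_pow (j k : nat) : {cmonom nat} := expcmn (ucm j) k.
#[global] Arguments var_pow : simpl never.

Lemma var_powE j k i : var_pow j k i = ((j == i) * k)%N.
Proof. by rewrite expcmnE cmU mulnC. Qed.

Lemma divcm_var_powK m j k : (k <= m j)%N -> mmul (divcm m (var_pow j k)) (var_pow j k) = m.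
Proof.
move=> km; apply/eqP/cmP => i; rewrite cmM divcmE var_powE.
by case: eqP => [<-|_]; rewrite ?mul0n ?subn0 ?addn0 // mul1n subnK.
Qed.

Lemma ps_mul_var_pow (f : psring) j k m :
  (f * ps_sum [set var_pow j k]%classic) m =
  if (k <= m j)%N then f (divcm m (var_pow j k)) else 0.
Proof.
have g1 c : ps_sum [set var_pow j k]%classic c = (c == var_pow j k)%:R.
  by apply: ps_sumE; split => [->|/eqP].
rewrite (@ps_mul_supp _ _ _ [seq c <- [:: var_pow j k] | (k <= m j)%N]).
- by case: ifP => _; rewrite ?big_seq1 ?big_nil // g1 eqxx mulr1.
- exact: filter_uniq.
- by move=> c; rewrite mem_filter inE => /andP[km /eqP->]; apply: divcm_var_powK.
move=> a c ac; rewrite g1; case: (c =P var_pow j k) => // cE _.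
by rewrite mem_filter inE cE eqxx andbT -ac cE cmM var_powE eqxx mul1n leq_addl.
Qed.

Lemma ps_var_exp j k : ps_var j ^+ k = ps_sum [set var_pow j k]%classic.
Proof.
elim: k => [|k IH].
  by apply/funext => m; rewrite expr0; apply/esym/ps_sumE; split => [->|/eqP].
rewrite exprSr IH; apply/funext => m.
have -> : ps_var j = ps_sum [set var_pow j 1]%classic by [].
rewrite ps_mul_var_pow; apply/esym.
have -> : (if (1 <= m j)%N then ps_sum [set var_pow j k]%classic (divcm m (var_pow j 1)) else 0)
  = ((1 <= m j)%N && (divcm m (var_pow j 1) == var_pow j k))%:R :> int.
  by case: ifP => //= _; apply: ps_sumE; split => [->|/eqP].
apply: ps_sumE; split => [->|/andP[m1 /eqP E]].
  rewrite var_powE eqxx; apply/cmP => i; rewrite divcmE !var_powE.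
  by case: eqP; rewrite ?mul0n // !mul1n subn1.
rewrite -(divcm_var_powK m1) E; apply/eqP/cmP => i; rewrite cmM !var_powE.
by case: eqP; rewrite ?mul0n // !mul1n addn1.
Qed.

(** [qsM [:: k]] is the power sum p_k, supported on the monomials [var_pow j k]. *)
Lemma ps_mul_qsM1 (f : psring) k m : (0 < k)%N ->
  (f * qsM [:: k]) m = \sum_(j <- mvars m | (k <= m j)%N) f (divcm m (var_pow j k)).
Proof.
move=> k0.
have gE c : qsM [:: k] c != 0 -> exists j, c = var_pow j k.
  rewrite qsME /= ?k0 //; case: (mexp c =P _) => // E _.
  have := monomial_mexp c; rewrite E /monomial; have := congr1 size E.
  rewrite size_map; case: (mvars c) => [|j [|? ?]] //= _ <-.
  by exists j; rewrite big_seq1.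
have var_pow_inj : injective (var_pow^~ k).
  move=> i j /(congr1 (fun c : {cmonom nat} => c j)); rewrite !var_powE eqxx.
  by case: eqP => // _; rewrite mul0n mul1n => k0'; rewrite -k0' in k0.
have g1 j : qsM [:: k] (var_pow j k) = 1.
  apply: (@ps_sumE _ _ true); split => // _; exists [:: j] => //.
  by rewrite /monomial big_seq1.
rewrite (@ps_mul_supp _ _ _ [seq var_pow j k | j <- mvars m & (k <= m j)%N]).
- rewrite big_map big_filter; apply: eq_bigr => j _.
  by rewrite g1 mulr1.
- by rewrite map_inj_uniq // filter_uniq // mvars_uniq.
- by move=> _ /mapP[j + ->]; rewrite mem_filter => /andP[km _]; apply: divcm_var_powK.
move=> a c ac /gE[j cE]; apply/mapP; exists j => //.
have km : (k <= m j)%N by rewrite -ac cE cmM var_powE eqxx mul1n leq_addl.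
by rewrite mem_filter km mem_mvars -lt0n (leq_trans k0).
Qed.

Definition rootm (n : nat) m : {cmonom nat} :=
  monomial (mvars m) [seq (k %/ n)%N | k <- mexp m].

Lemma rootmE n m j : rootm n m j = (m j %/ n)%N.
Proof.
rewrite /rootm monomial_nth ?mvars_uniq ?size_map //.
have [jm|jm] := boolP (j \in mvars m).
  by rewrite -map_comp (nth_map 0%N) ?index_mem //= nth_index.
rewrite nth_default ?size_map ?memNindex //.
by move: jm; rewrite mem_mvars negbK => /eqP->; rewrite div0n.
Qed.

(* The endomorphism x_i |-> x_i ^ n of the ring of power series. *)
Definition frob (n : nat) (f : psring) : psring := fun m =>
  if expcmn (rootm n m) n == m then f (rootm n m) else 0.

Lemma rootmK n m : (0 < n)%N -> rootm n (expcmn m n) = m.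
Proof. by move=> n0; apply/eqP/cmP => i; rewrite rootmE expcmnE mulKn. Qed.

Lemma frob_exp n f m : (0 < n)%N -> frob n f (expcmn m n) = f m.
Proof. by move=> n0; rewrite /frob rootmK ?eqxx. Qed.

Lemma frob_out n f m : (forall m', m != expcmn m' n) -> frob n f m = 0.
Proof. by move=> h; rewrite /frob eq_sym (negPf (h _)). Qed.

Lemma exp_ind n m : (exists m', m = expcmn m' n) \/ (forall m', m != expcmn m' n).
Proof.
have [h|h] := EM (exists m', m = expcmn m' n); [by left|right => m'].
by apply/eqP => E; apply: h; exists m'.
Qed.

Lemma frobD n : {morph frob n : f g / f + g}.
Proof.
move=> f g; apply/funext => m; rewrite [RHS]/GRing.add /= /frob.
by case: ifP => // _; rewrite addr0.
Qed.

Lemma expcmn_inj n : (0 < n)%N -> injective (fun m => expcmn m n).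
Proof. by move=> n0; apply: can_inj => m; apply: rootmK. Qed.

Lemma expcmn_mul n m1 m2 : expcmn (mmul m1 m2) n = mmul (expcmn m1 n) (expcmn m2 n).
Proof. by apply/eqP/cmP => i; rewrite cmM !expcmnE cmM mulnDr. Qed.

Lemma expcmn1 n : expcmn (mone : {cmonom nat}) n = mone.
Proof. by apply/eqP/cmP => i; rewrite expcmnE cm1 muln0. Qed.

Lemma frob1 n : (0 < n)%N -> frob n 1 = 1.
Proof.
move=> n0; apply/funext => m; have [[m' ->]|h] := exp_ind n m.
  rewrite frob_exp // /GRing.one /= /ps_one -[in RHS](expcmn1 n).
  by rewrite (inj_eq (expcmn_inj n0)).
rewrite frob_out // /GRing.one /= /ps_one; move: (h mone).
by rewrite expcmn1 => /negPf->.
Qed.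

(** A product of n-th powers is an n-th power, and the factorizations of [expcmn m' n] into n-th
    powers correspond to the factorizations of [m']. *)
Lemma frobM n : (0 < n)%N -> {morph frob n : f g / f * g}.
Proof.
move=> n0 f g; apply/funext => m.
have E (f' g' : psring) m' : (f' * g') m' =
    \sum_(p \in [set p : {cmonom nat} * {cmonom nat} | mmul p.1 p.2 = m']%classic) f' p.1 * g' p.2 by [].
rewrite E; have [[m' ->]|h] := exp_ind n m; last first.
  rewrite frob_out // fsbig1 // => -[a b] /= ab.
  have [[a' Ea]|ha] := exp_ind n a; last by rewrite frob_out // mul0r.
  have [[b' Eb]|hb] := exp_ind n b; last by rewrite [X in _ * X]frob_out // mulr0.
  by move: (h (mmul a' b')); rewrite expcmn_mul -Ea -Eb ab eqxx.
rewrite frob_exp // E.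
pose h (p : {cmonom nat} * {cmonom nat}) := (expcmn p.1 n, expcmn p.2 n).
rewrite -[RHS](@fsbig_widen _ _ _ _ (h @` [set p | mmul p.1 p.2 = m'])%classic).
- rewrite fsbig_image /=; first by apply: eq_fsbigr => p _; rewrite !frob_exp.
  by move=> [a b] [a' b'] _ _ [/(expcmn_inj n0)-> /(expcmn_inj n0)->].
- by move=> _ [p /= <- <-]; rewrite expcmn_mul.
move=> [a b] /= [ab nab].
have [[a' Ea]|ha] := exp_ind n a; last by rewrite frob_out // mul0r.
have [[b' Eb]|hb] := exp_ind n b; last by rewrite [X in _ * X]frob_out // mulr0.
case: nab; exists (a', b'); rewrite /h /= ?Ea ?Eb //.
by apply: (expcmn_inj n0); rewrite expcmn_mul -Ea -Eb.
Qed.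

Lemma mexp_expcmn n m : (0 < n)%N -> mexp (expcmn m n) = scale_comp n (mexp m).
Proof.
move=> n0; rewrite -[in LHS](monomial_mexp m).
have -> : expcmn (monomial (mvars m) (mexp m)) n
    = monomial (mvars m) (scale_comp n (mexp m)).
  apply/eqP/cmP => i; rewrite expcmnE !monomial_nth ?mvars_uniq ?size_map //.
  have [im|im] := boolP (i \in mvars m).
    by rewrite [in RHS](nth_map 0%N) // ?size_map index_mem.
  by rewrite !nth_default ?muln0 ?size_map ?memNindex.
rewrite mexp_monomial ?size_map // ?mvars_sorted //.
apply/allP => _ /mapP[k km ->]; rewrite muln_gt0 n0; exact: (allP (mexp_gt0 m)).
Qed.

Lemma dvd_mexp n m : all (dvdn n) (mexp m) -> exists m', m = expcmn m' n.
Proof.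
move=> /allP h; exists (rootm n m); apply/eqP/cmP => j.
rewrite expcmnE rootmE mulnC divnK //.
have [jm|] := boolP (j \in mvars m); first by apply: h; apply: map_f.
by rewrite mem_mvars negbK => /eqP->.
Qed.

Lemma scale_comp_pos n al : (0 < n)%N -> all (leq 1) al -> all (leq 1) (scale_comp n al).
Proof. by move=> n0 /allP h; apply/allP => _ /mapP[a /h a0 ->]; rewrite muln_gt0 n0. Qed.

Lemma scale_composition n al : (0 < n)%N -> composition al -> composition (scale_comp n al).
Proof.
move=> n0 /andP[ne pal]; rewrite /composition scale_comp_pos // andbT.
by case: al ne {pal}.
Qed.

Lemma frob_qsM n al : (0 < n)%N -> all (leq 1) al -> frob n (qsM al) = qsM (scale_comp n al).
Proof.
move=> n0 pal; apply/funext => m; rewrite [RHS]qsME ?scale_comp_pos //.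
have inj : injective (scale_comp n).
  by apply: inj_map => a b /eqP; rewrite eqn_pmul2l // => /eqP.
have [[m' ->]|h] := exp_ind n m.
  by rewrite frob_exp // qsME // mexp_expcmn // (inj_eq inj).
rewrite frob_out //; case: eqP => // E.
have [|m' E'] := @dvd_mexp n m; last by move: (h m'); rewrite -E' eqxx.
by rewrite E; apply/allP => _ /mapP[a _ ->]; rewrite dvdn_mulr.
Qed.

(** * The formula for theta *)

Section ZSpan.
Variables (V : zmodType) (X : set V).

Lemma zspan_zmod_closed : zmod_closed (zspan X).
Proof.
split=> [|x y /asboolP[s [sX ->]] /asboolP[t [tX ->]]]; apply/asboolP.
  by exists [::]; rewrite big_nil.
exists (s ++ [seq (- p.1, p.2) | p <- t]); split=> [p|].
  by rewrite mem_cat => /orP[/sX|/mapP[q /tX ? ->]].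
rewrite big_cat big_map /= -sumrN; congr (_ + _).
by apply: eq_bigr => p _; rewrite mulrNz.
Qed.

HB.instance Definition _ := GRing.isZmodClosed.Build V (zspan X) zspan_zmod_closed.

Lemma zspan_gen x : X x -> x \in zspan X.
Proof.
by move=> Xx; apply/asboolP; exists [:: (1, x)]; split=> [p|]; rewrite ?big_seq1 // inE => /eqP->.
Qed.

Lemma zspan_ind (K : V -> Prop) : K 0 -> (forall x, X x -> K x) ->
  (forall x y, K x -> K y -> K (x - y)) -> {in zspan X, forall x, K x}.
Proof.
move=> K0 KX KB _ /asboolP[s [sX ->]].
have KD x y : K x -> K y -> K (x + y).
  by move=> Kx Ky; rewrite -[y]opprK -[- y]sub0r; apply: (KB) => //; apply: KB.
elim: s sX => [|p s IH] sX; first by rewrite big_nil.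
rewrite big_cons; apply: (KD); last by apply: IH => q qs; apply: sX; rewrite inE qs orbT.
have Kp : K p.2 by apply/KX/sX; rewrite mem_head.
have Kn k : K (p.2 *+ k) by elim: k => // k IHk; rewrite mulrS; apply: KD.
case: (p.1) => k; rewrite ?NegzE ?mulrNz; first exact: Kn.
by rewrite -sub0r; apply: (KB) => //; apply: (Kn k.+1).
Qed.

End ZSpan.

HB.instance Definition _ := GRing.isZmodClosed.Build psring QSym (zspan_zmod_closed _).
HB.instance Definition _ := GRing.isZmodClosed.Build psring PQSym (zspan_zmod_closed _).

Section MorphOn.
Variables (V W : zmodType) (S : zmodClosed V) (f : V -> W).
Hypothesis fD : {in S &, {morph f : x y / x + y}}.

Lemma morph_on0 : f 0 = 0.
Proof. by apply: (addrI (f 0)); rewrite -fD ?rpred0 // !addr0. Qed.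

Lemma morph_onN : {in S, {morph f : x / - x}}.
Proof.
by move=> x xS; apply: (addrI (f x)); rewrite -fD ?rpredN // !subrr morph_on0.
Qed.

Lemma morph_onB : {in S &, {morph f : x y / x - y}}.
Proof. by move=> x y xS yS; rewrite fD ?rpredN // morph_onN. Qed.

Lemma morph_on_sum (I : Type) (r : seq I) (P : pred I) (F : I -> V) :
  (forall i, P i -> F i \in S) ->
  f (\sum_(i <- r | P i) F i) = \sum_(i <- r | P i) f (F i).
Proof.
move=> FS; elim: r => [|i r IH]; first by rewrite !big_nil morph_on0.
by rewrite !big_cons; case: ifP => // Pi; rewrite fD ?FS ?rpred_sum // IH.
Qed.

Lemma morph_on_muln x k : x \in S -> f (x *+ k) = f x *+ k.
Proof.
move=> xS; elim: k => [|k IH]; first exact: morph_on0.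
by rewrite !mulrS fD ?rpredMn // IH.
Qed.

Lemma morph_on_mulz x z : x \in S -> f (x *~ z) = f x *~ z.
Proof.
move=> xS; case: z => k; first exact: morph_on_muln.
by rewrite NegzE !mulrNz morph_onN ?rpredMn //; congr (- _); apply: (morph_on_muln k.+1).
Qed.

End MorphOn.

Lemma qsM_QSym al : composition al -> qsM al \in QSym.
Proof. by move=> cal; apply: zspan_gen; right; exists al. Qed.

Lemma qsM_bcompE u : qsM (bcomp u) = \sum_(p <- signed_refs u) qsF (bcomp p.2) *~ p.1.
Proof.
apply/funext => m; rewrite ps_sumf qsME ?all_bcomp //.
have [->|m1] := eqVneq m mone.
  rewrite big1 => [|p _]; last by rewrite ps_mulz qsF1 mul0r.
  by have [a [s ->]] := bcompP u; rewrite mexp1.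
have [D ED] := bcomp_surj (mexp_composition m1).
rewrite ED (inj_eq bcomp_inj) eq_sym -signed_refs_bits_le; apply: eq_bigr => p _.
by rewrite ps_mulz (qsFE _ (esym ED)) mulrC.
Qed.

Lemma qsF_bcompE u : qsF (bcomp u) = \sum_(v <- refinements u) qsM (bcomp v).
Proof.
apply/funext => m; rewrite ps_sumf.
under eq_bigr => v _ do rewrite qsME ?all_bcomp //.
have [->|m1] := eqVneq m mone.
  rewrite qsF1 big1 // => v _; have [a [s ->]] := bcompP v.
  by rewrite mexp1.
have [D ED] := bcomp_surj (mexp_composition m1).
rewrite (qsFE _ (esym ED)) -refinements_sum; apply: eq_bigr => v _.
by rewrite ED (inj_eq bcomp_inj) eq_sym.
Qed.

Lemma qsF_QSym u : qsF (bcomp u) \in QSym.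
Proof.
by rewrite qsF_bcompE rpred_sum // => v _; apply/qsM_QSym/bcomp_composition.
Qed.

Lemma ps_mul_mone (f g : psring) : (f * g) mone = f mone * g mone.
Proof.
rewrite (@ps_mul_supp _ _ _ [:: mone]) ?big_seq1 //.
- by congr (f _ * _); apply/eqP/cmP => i; rewrite divcmE cm1.
- by move=> c; rewrite inE => /eqP->; apply/eqP/cmP => i; rewrite cmM divcmE cm1.
move=> a c /(congr1 (fun m => m == mone)); rewrite eqxx cmM_eq1 => /andP[_ /eqP->] _.
exact: mem_head.
Qed.

(** The candidate for Phi^n. For even [n], fixing 1 and killing every L forces the constant term. *)
Definition adamsPhi (n : nat) (f : psring) : psring :=
  if odd n then frob n f else (f mone)%:~R.

Lemma adamsPhiD n : {morph adamsPhi n : f g / f + g}.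
Proof. by move=> f g; rewrite /adamsPhi; case: odd; [exact: frobD|exact: intrD]. Qed.

Lemma adamsPhiM n : {morph adamsPhi n : f g / f * g}.
Proof.
move=> f g; rewrite /adamsPhi; case: ifP => [on|_]; first by rewrite frobM //; case: n on.
by rewrite ps_mul_mone intrM.
Qed.

Lemma adamsPhi1 n : adamsPhi n 1 = 1.
Proof.
rewrite /adamsPhi; case: ifP => [on|_]; first by rewrite frob1 //; case: n on.
by rewrite [(1 : psring) mone]/GRing.one /= /ps_one eqxx.
Qed.

(** [P] and [peaks al] live in different ordinal types until [sumn al = n] is substituted, so their
    elements are compared by value. *)
Lemma peakK_peaks al n (P : {set 'I_n}) : sumn al = n ->
    (forall k, (exists2 i : 'I_n, i \in P & i = k :> nat) <->
               (exists2 i, i \in peaks al & i = k :> nat)) ->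
  peakK P = peakK (peaks al).
Proof.
move=> E; case: n / E in P *; move=> h; congr peakK; apply/setP => i.
apply/idP/idP => [iP|iP].
  by have [|j jP /val_inj<-] := (h i).1; first by exists i.
by have [|j jP /val_inj<-] := (h i).2; first by exists i.
Qed.

(** Take the composition whose set D is [P]: since [P] has no adjacent elements and all are at least
    2, each of them is a peak. *)
Lemma peakK_surj n (P : {set 'I_n}) : (0 < n)%N -> peak_subset P ->
  exists u, peakK P = peakK (peaks (bcomp u)).
Proof.
move=> n0 hP; pose u := mkseq (fun k => [exists i in P, (i : nat) == k.+1]) n.-1.
exists u; have sz : sumn (bcomp u) = n by rewrite sumn_bcomp size_mkseq prednK.
apply: peakK_peaks => // k.
have nu j : nth false u j = [exists i in P, (i : nat) == j.+1].
  case: (ltnP j n.-1) => jn; first by rewrite nth_mkseq.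
  rewrite nth_default ?size_mkseq //; apply/esym/negbTE/existsPn => i.
  by apply/negP => /andP[_ /eqP E]; have := ltn_ord i; lia.
have mem_u (i : nat) : (i \in Dset (bcomp u)) <-> exists2 j : 'I_n, j \in P & j = i :> nat.
  rewrite Dset_bcomp nu; split=> [/andP[i0 /exists_inP[j jP /eqP E]]|[j jP E]].
    by exists j; rewrite // E prednK.
  have [j2 _] := hP _ jP; have i0 : (0 < i)%N by rewrite -E; lia.
  by rewrite i0; apply/exists_inP; exists j => //; rewrite prednK // E.
split=> [[i iP E]|[i iP E]].
  have [i2 ni] := hP _ iP; have ki : (k < sumn (bcomp u))%N by rewrite sz -E.
  exists (Ordinal ki) => //; rewrite inE /= -E i2 /=; apply/andP; split.
    by apply/mem_u; exists i.
  by apply/negP => /mem_u[j /ni].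
by move: iP; rewrite inE => /and3P[_ /mem_u[j jP Ej] _]; exists j; rewrite // Ej.
Qed.

Section Theta.
Variable theta : psring -> psring.
Hypothesis thetaP : is_theta theta.

Let thetaD : {in QSym &, {morph theta : x y / x + y}}.
Proof. by case: thetaP => -[]. Qed.

Lemma theta1 : theta 1 = 1. Proof. by case: thetaP => -[]. Qed.

Lemma theta0 : theta 0 = 0. Proof. exact: (morph_on0 thetaD). Qed.

Lemma thetaB : {in QSym &, {morph theta : x y / x - y}}.
Proof. exact: (morph_onB thetaD). Qed.

(** Expand M into the F by [qsM_bcompE], replace each F by its K, and read coefficients with
    [peakK_bcomp]; what remains is [covered_sum true]. *)
Lemma theta_qsM al m : composition al ->
  theta (qsM al) m = theta_coef al (mexp m) *+ 2 ^ size (mexp m).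
Proof.
case/bcomp_surj => u ->; rewrite qsM_bcompE (morph_on_sum thetaD); last first.
  by move=> p _; apply: rpredMz; apply: qsF_QSym.
rewrite ps_sumf.
have E p : theta (qsF (bcomp p.2) *~ p.1) m = peakK (peaks (bcomp p.2)) m * p.1.
  rewrite (morph_on_mulz thetaD) ?qsF_QSym // ps_mulz.
  by case: thetaP => _ -> //; apply: bcomp_composition.
under eq_bigr => p _ do rewrite E.
have [->|m1] := eqVneq m mone.
  rewrite mexp1 theta_coef_sumn ?mul0rn; last by rewrite sumn_bcomp.
  rewrite big1 // => p _; rewrite /peakK ps_muln ps_sumf big1 ?mul0rn ?mul0r // => b.
  by case/andP => /bcomp_surj[v ->] _; rewrite qsF1.
have [D ED] := bcomp_surj (mexp_composition m1).
under eq_bigr => p _ do rewrite (peakK_bcomp _ (esym ED)).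
have [szu|nsz] := eqVneq (size u) (size D); last first.
  rewrite theta_coef_sumn ?mul0rn ?ED ?sumn_bcomp ?eqSS //.
  rewrite big1_seq // => p /= /signed_refs_size ->.
  by rewrite (negPf nsz) mul0rn mul0r.
rewrite ED; have [<- _] := covered_sum_theta_coef szu.
rewrite /covered_sum -sumrMnl; apply: eq_big_seq => p /signed_refs_size ->.
by rewrite szu eqxx mulrnAl [in LHS]mulrC.
Qed.

Lemma theta_image f : f \in PQSym -> exists2 g, g \in QSym & theta g = f.
Proof.
apply: (zspan_ind (K := fun f => exists2 g, g \in QSym & theta g = f)) => {f}.
- by exists 0; rewrite ?rpred0 ?theta0.
- move=> f [->|[n [P [n0 hP ->]]]].
    by exists 1; [apply: zspan_gen; left|apply: theta1].
  have [u ->] := peakK_surj n0 hP; exists (qsF (bcomp u)); first exact: qsF_QSym.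
  by case: thetaP => _; apply; apply: bcomp_composition.
- by move=> _ _ [g gQ <-] [h hQ <-]; exists (g - h); rewrite ?rpredB ?thetaB.
Qed.

Lemma QSym_ind (K : psring -> Prop) : K 0 -> K 1 ->
    (forall al, composition al -> K (qsM al)) ->
    (forall f g, f \in QSym -> g \in QSym -> K f -> K g -> K (f - g)) ->
  {in QSym, forall f, K f}.
Proof.
move=> K0 K1 KM KB f fQ.
suff [] : f \in QSym /\ K f by [].
move: f fQ; apply: (zspan_ind (K := fun f => f \in QSym /\ K f)).
- by rewrite rpred0.
- move=> f Xf; split; first exact: zspan_gen.
  by case: Xf => [->|[al cal ->]] //; apply: KM.
- by move=> f g [fQ Kf] [gQ Kg]; rewrite rpredB //; split=> //; apply: KB.
Qed.

Lemma frob0 n : frob n 0 = 0.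
Proof. by apply/funext => m; rewrite /frob; case: ifP. Qed.

Lemma frobB n : {morph frob n : f g / f - g}.
Proof.
move=> f g; apply/funext => m; rewrite [RHS]/GRing.add /= /frob /GRing.opp /=.
by rewrite /frob; case: ifP => // _; rewrite subr0.
Qed.

Lemma frob_QSym n : (0 < n)%N -> {in QSym, forall f, frob n f \in QSym}.
Proof.
move=> n0; apply: QSym_ind.
- by rewrite frob0 rpred0.
- by rewrite frob1 //; apply: zspan_gen; left.
- move=> al cal; case/andP: (cal) => _ pal; rewrite frob_qsM //.
  exact/qsM_QSym/scale_composition.
- by move=> f g _ _ fn gn; rewrite frobB rpredB.
Qed.

Lemma adamsPhi0 n : adamsPhi n 0 = 0.
Proof. by apply: (addrI (adamsPhi n 0)); rewrite -adamsPhiD !addr0. Qed.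

Lemma adamsPhiN n : {morph adamsPhi n : f / - f}.
Proof. by move=> f; apply: (addrI (adamsPhi n f)); rewrite -adamsPhiD !subrr adamsPhi0. Qed.

(** Compared on the M. For odd [n] the coefficients at n-th powers agree by [theta_coef_scale] and
    the others vanish by [theta_coef_ndvd]; for even [n] use [theta_coef_even]. *)
Lemma theta_frob n : (0 < n)%N ->
  {in QSym, forall f, theta (frob n f) = adamsPhi n (theta f)}.
Proof.
move=> n0; apply: QSym_ind.
- by rewrite frob0 theta0 adamsPhi0.
- by rewrite frob1 // theta1 adamsPhi1.
- move=> al cal; case/andP: (cal) => ne pal; rewrite frob_qsM //.
  apply/funext => m; rewrite theta_qsM ?scale_composition // /adamsPhi.
  case: ifP => [on|/negbT en]; last first.
    by rewrite theta_coef_even // mul0rn theta_qsM // mexp1; case: (al) ne.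
  have [[m' ->]|h] := exp_ind n m.
    by rewrite frob_exp // theta_qsM // mexp_expcmn // theta_coef_scale // size_map.
  rewrite frob_out // theta_coef_ndvd ?mul0rn //.
  by apply/negP => /dvd_mexp[m' E]; move: (h m'); rewrite -E eqxx.
- move=> f g fQ gQ Ef Eg; rewrite frobB !thetaB ?frob_QSym // Ef Eg.
  by rewrite -adamsPhiN -adamsPhiD.
Qed.

Lemma adamsPhi_PQSym n : (0 < n)%N -> {in PQSym, forall f, adamsPhi n f \in PQSym}.
Proof.
move=> n0 _ /theta_image[g gQ <-]; rewrite -theta_frob //.
by case: thetaP => -[+ _ _ _] _; apply; apply: frob_QSym.
Qed.

Lemma adamsPhi_is_Phi n : (0 < n)%N -> is_Phi theta n (adamsPhi n).
Proof.
move=> n0; split.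
  split; [exact: adamsPhi_PQSym|exact: adamsPhi1|by move=> *; apply: adamsPhiD|].
  by move=> *; apply: adamsPhiM.
move=> al /andP[cal _]; rewrite /peakL -theta_frob ?qsM_QSym //.
case/andP: (cal) => ne pal; rewrite frob_qsM //; case: ifP => // /negbT en.
apply/funext => m; rewrite theta_qsM ?scale_composition //.
by rewrite theta_coef_even ?mul0rn.
Qed.

(** This is why 1 and the L indexed by odd compositions span [PQSym]. *)
Lemma theta_qsM_odd al : composition al ->
  exists2 p : int * seq nat, odd_composition p.2 & theta (qsM al) = theta (qsM p.2) *~ p.1.
Proof.
move=> cal; have [[e be] ob E] := theta_coef_odd cal; exists (e, be) => //.
apply/funext => m; case/andP: ob => cbe _.
by rewrite ps_mulz !theta_qsM // E /= mulrnAl mulrC.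
Qed.

Lemma is_Phi_uniq n g : (0 < n)%N -> is_Phi theta n g -> {in PQSym, g =1 adamsPhi n}.
Proof.
move=> n0 [[_ g1 gD _] gL] _ /theta_image[h hQ <-].
have [[thQ _ _ _] _] := thetaP.
move: h hQ; apply: QSym_ind.
- by rewrite theta0 adamsPhi0 (morph_on0 gD).
- by rewrite theta1 adamsPhi1 g1.
- move=> al cal; have [[e be] /= ob ->] := theta_qsM_odd cal.
  have [[_ _ _ _] PL] := adamsPhi_is_Phi n0.
  have bP : theta (qsM be) \in PQSym by apply/thQ/qsM_QSym; case/andP: ob.
  have aD : {in PQSym &, {morph adamsPhi n : x y / x + y}} by move=> *; apply: adamsPhiD.
  by rewrite (morph_on_mulz gD) // (morph_on_mulz aD) // gL // PL.
- move=> f f' fQ f'Q Ef Ef'; rewrite thetaB // adamsPhiD adamsPhiN.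
  by rewrite (morph_onB gD) ?thQ // Ef Ef'.
Qed.

End Theta.

(** * Generalities on lambda-rings *)

Section Adams.
Variables (R : comNzRingType) (S : subringClosed R) (lam Psi : nat -> R -> R).
Hypotheses (lamP : lambda_ring_on S lam) (PsiP : adams_on S lam Psi).

Let D x i := (-1) ^+ i * Psi i.+1 x.

(* Compare logarithmic derivatives of lambda_t(x + y) = lambda_t(x) lambda_t(y) *)
(* modulo t ^ (n + 1).                                                         *)
Lemma adams_add n : {in S &, {morph Psi n.+1 : x y / x + y}}.
Proof.
move=> x y xS yS; have xyS : x + y \in S by rewrite rpredD.
pose eqt (p q : {poly R}) := forall k, (k <= n)%N -> p`_k = q`_k.
have eqtM p p' q q' : eqt p p' -> eqt q q' -> eqt (p * q) (p' * q').
  move=> pp qq k kn; rewrite !coefM; apply: eq_bigr => i _.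
  by rewrite pp ?qq // ?(leq_trans (leq_subr _ _)) // -ltnS (leq_trans (ltn_ord i)).
pose L z := \poly_(i < n.+2) lam i z; pose T z := \poly_(i < n.+1) D z i.
have dL z : z \in S -> eqt (L z)^`() (L z * T z).
  move=> zS k kn; rewrite coef_deriv coef_poly ltnS ltnS kn (PsiP zS) coefMr.
  apply: eq_bigr => i _; rewrite !coef_poly.
  have ik : (i <= k)%N by rewrite -ltnS.
  have -> : (i < n.+1)%N by lia.
  by have -> : (k - i < n.+2)%N by lia.
have LM k : (k <= n.+1)%N -> (L (x + y))`_k = (L x * L y)`_k.
  move=> kn; rewrite coef_poly ltnS kn (lambda_add lamP) // coefM.
  apply: eq_bigr => i _; rewrite !coef_poly; have ik := ltn_ord i.
  have -> : (i < n.+2)%N by lia.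
  by have -> : (k - i < n.+2)%N by lia.
have LM' : eqt (L (x + y)) (L x * L y) by move=> k kn; apply/LM/leqW.
have dLM : eqt (L (x + y))^`() (L x * L y)^`().
  by move=> k kn; rewrite !coef_deriv LM.
(* Both sides are the derivative of [L (x + y)], the right one by the Leibniz rule. *)
have main : eqt (L (x + y) * T (x + y)) (L (x + y) * (T x + T y)).
  move=> k kn; rewrite -dL // dLM // derivM coefD.
  rewrite (eqtM _ _ _ _ (dL x xS) (fun i _ => erefl)) //.
  rewrite (eqtM _ _ _ _ (fun i _ => erefl) (dL y yS)) // -coefD.
  rewrite (eqtM _ _ _ _ LM' (fun i _ => erefl)) //.
  by rewrite mulrDr mulrA [L x * T x * _]mulrAC.
(* [L (x + y)] has constant coefficient 1, so it cancels degree by degree. *)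
have {main} TD k : (k <= n)%N -> (T (x + y) - (T x + T y))`_k = 0.
  have [N] := ubnP k; elim: N k => // N IH k; rewrite ltnS => kN kn.
  have := main k kn; move/eqP; rewrite -subr_eq0 -coefB -mulrBr coefM.
  rewrite big_ord_recl big1 ?addr0 => [|i _].
    by rewrite /= subn0 coef_poly /= (lambda_0 lamP) // mul1r => /eqP.
  rewrite lift0 IH ?mulr0 //.
    by apply: leq_trans kN; have := ltn_ord i; rewrite /=; lia.
  by apply: leq_trans kn; exact: leq_subr.
have := TD n (leqnn n); rewrite coefB coefD !coef_poly ltnSn => /subr0_eq.
by rewrite /D -mulrDr => /(can_inj (signrMK n)).
Qed.

(** Since lambda_t(1) = 1 + t, the logarithmic derivative is 1/(1 + t). *)
Lemma adams_1 n : Psi n.+1 1 = 1.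
Proof.
have S1 : 1 \in S by rewrite rpred1.
elim: n => [|n IH].
  have := PsiP S1 0; rewrite big_ord1 mulr1n (lambda_1 lamP) // (lambda_0 lamP) //.
  by rewrite expr0 !mul1r.
have := PsiP S1 n.+1; rewrite (lambda_one lamP) // mul0rn big_ord_recr big_ord_recr /=.
rewrite big1 => [|i _]; last first.
  by rewrite (lambda_one lamP) ?mul0r //; have := ltn_ord i; lia.
rewrite subnn subSnn (lambda_0 lamP) // (lambda_1 lamP) // IH !mul1r add0r exprS.
rewrite mulN1r mulNr => /esym/eqP; rewrite subr_eq0 => /eqP E.
by apply: (can_inj (signrMK n)); rewrite -E.
Qed.

End Adams.

Section ZEval.
Variables (R : comNzRingType) (S : subringClosed R).

Lemma zeval_closed n (v : 'I_n -> R) P : (forall i, v i \in S) -> zeval v P \in S.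
Proof.
move=> vS; rewrite /zeval /mpoly.mmap; apply: rpred_sum => m _.
by rewrite rpredM ?rpredMz ?rpred1 //; apply: rpred_prod => i _; rewrite rpredX.
Qed.

Variables (R' : comNzRingType) (f : R -> R').
Hypotheses (f1 : f 1 = 1) (fD : {in S &, {morph f : x y / x + y}})
  (fM : {in S &, {morph f : x y / x * y}}).

Lemma morph_on_prod (I : Type) (r : seq I) (F : I -> R) :
  (forall i, F i \in S) -> f (\prod_(i <- r) F i) = \prod_(i <- r) f (F i).
Proof.
move=> FS; elim: r => [|i r IH]; first by rewrite !big_nil f1.
by rewrite !big_cons fM ?FS ?rpred_prod // IH.
Qed.

Lemma morph_on_exp x k : x \in S -> f (x ^+ k) = f x ^+ k.
Proof.
move=> xS; elim: k => [|k IH]; first by rewrite !expr0 f1.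
by rewrite !exprS fM ?rpredX // IH.
Qed.

Lemma zeval_morph n (v : 'I_n -> R) P : (forall i, v i \in S) ->
  f (zeval v P) = zeval (fun i => f (v i)) P.
Proof.
move=> vS; have XS (k : 'X_{1..n}) : mpoly.mmap1 v k \in S.
  by apply: rpred_prod => i _; rewrite rpredX.
rewrite /zeval /mpoly.mmap (morph_on_sum fD) => [|m _]; last first.
  by rewrite rpredM ?rpredMz ?rpred1.
apply: eq_bigr => m _; rewrite fM ?rpredMz ?rpred1 //.
rewrite (morph_on_mulz fD) ?rpred1 // f1; congr (_ * _).
rewrite /mpoly.mmap1 morph_on_prod => [|i]; last by rewrite rpredX.
by apply: eq_bigr => i _; rewrite morph_on_exp.
Qed.

End ZEval.

Lemma subring_pack (R : comNzRingType) (S : {pred R}) :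
  subring_closed S -> {S' : subringClosed R | S = S' :> {pred R}}.
Proof.
move=> HS; pose S' : subringClosed R :=
  HB.pack S (GRing.isSubringClosed.Build R S HS).
by exists S'.
Qed.

(** The axioms are integer polynomial identities in the values of the operations, so [f] transports
    them, and surjectivity reaches all of [S']. *)
Lemma lambda_ring_quotient (R R' : comNzRingType) (S : {pred R}) (S' : {pred R'})
    (lam : nat -> R -> R) (lam' : nat -> R' -> R') (f : R -> R') :
    lambda_ring_on S lam -> ring_hom_on S S' f ->
    {in S', forall y, exists2 x, x \in S & f x = y} ->
    (forall n, {in S, forall x, lam' n (f x) = f (lam n x)}) ->
  lambda_ring_on S' lam'.
Proof.
move=> L; have [S0 ES] := subring_pack (lambda_subringP L); subst S.
move=> [fS f1 fD fM] surj lamE; have lS := lambda_closed L.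
have zeval2E n u v P : (forall i, u i \in S0) -> (forall i, v i \in S0) ->
    f (@zeval2 _ n u v P) = zeval2 (f \o u) (f \o v) P.
  move=> uS vS; rewrite /zeval2 (zeval_morph f1 fD fM).
    by congr zeval; apply/funext => k; case: fintype.split.
  by move=> k; case: fintype.split.
constructor.
- split; first by rewrite -f1 fS ?rpred1.
    move=> _ _ /surj[x xS <-] /surj[y yS <-].
    by rewrite -(morph_onB fD) // fS ?rpredB.
  by move=> _ _ /surj[x xS <-] /surj[y yS <-]; rewrite -fM // fS ?rpredM.
- by move=> n _ /surj[x xS <-]; rewrite lamE // fS ?lS.
- by move=> _ /surj[x xS <-]; rewrite lamE // (lambda_0 L).
- by move=> _ /surj[x xS <-]; rewrite lamE // (lambda_1 L).
- move=> n _ _ /surj[x xS <-] /surj[y yS <-].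
  rewrite -fD // lamE ?rpredD // (lambda_add L) // (morph_on_sum fD) => [|i _].
    by apply: eq_bigr => i _; rewrite fM ?lS // !lamE.
  by rewrite rpredM ?lS.
- by move=> n n2; rewrite -f1 lamE ?rpred1 // (lambda_one L) // (morph_on0 fD).
- move=> n; have [P uP PE] := lambda_mul L n; exists P => //.
  move=> _ _ /surj[x xS <-] /surj[y yS <-].
  rewrite -fM // lamE ?rpredM // PE // zeval2E => [|i|i]; try exact: lS.
  by congr zeval2; apply/funext => i /=; rewrite lamE.
move=> m n; have [P uP PE] := lambda_comp L m n; exists P => //.
move=> _ /surj[x xS <-]; rewrite !lamE ?lS // PE // (zeval_morph f1 fD fM).
  by congr zeval; apply/funext => i /=; rewrite lamE.
by move=> i; apply: lS.
Qed.

(** The elements of [G] whose images under all operations stay in [G] form a subring, by the axioms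
    for sums and products. It contains the generators, since lambda^j(lambda^k(x)) is a polynomial
    in the lambda^i(x). *)
Lemma lambda_subring_generated (R : comNzRingType) (S G : {pred R})
    (lam : nat -> R -> R) (x : R) :
    lambda_ring_on S lam -> x \in S -> {subset G <= S} -> subring_closed G ->
    (forall n, lam n x \in G) ->
    (forall T : {pred R}, subring_closed T ->
       (forall n, (0 < n)%N -> lam n x \in T) -> {subset G <= T}) ->
  forall n, {in G, forall y, lam n y \in G}.
Proof.
move=> L xS GS HG lamG Gmin n y yG.
have [G0 EG] := subring_pack HG; subst G.
pose T : {pred R} := fun z => `[< z \in G0 /\ forall k, lam k z \in G0 >].
have TP z : reflect (z \in G0 /\ forall k, lam k z \in G0) (z \in T) by apply: asboolP.
suff : y \in T by case/TP.
(* By induction, expanding lambda^k(0 + 0) leaves only its two extreme terms, each equal to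
   lambda^k(0). *)
have lam0 k : (0 < k)%N -> lam k 0 = 0.
  have S0 : 0 \in S by rewrite GS ?rpred0.
  have [N] := ubnP k; elim: N k => // N IH k; rewrite ltnS => kN k0.
  have := lambda_add L k S0 S0; rewrite addr0.
  rewrite big_ord_recl; case: k k0 kN => // k _ kN.
  rewrite big_ord_recr /= subn0 subnn (lambda_0 L) // mul1r mulr1 big1 => [|i _].
    by rewrite add0r => /esym/eqP; rewrite -subr_eq0 addrK => /eqP.
  by rewrite /bump /= add1n IH ?mul0r // (leq_trans _ kN) // ltnS ltn_ord.
apply: Gmin yG; last first.
  move=> k k0; apply/TP; split=> // j; have [P _ ->] := lambda_comp L j k => //.
  exact: zeval_closed.
split.
- apply/TP; split=> [|[|[|k]]]; rewrite ?rpred1 // ?(lambda_0 L) ?(lambda_1 L) ?GS ?rpred1 //.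
  by rewrite (lambda_one L) ?rpred0.
- move=> a b /TP[aG la] /TP[bG lb]; apply/TP; split; first by rewrite rpredB.
  (* lambda_t(-b) is the inverse of lambda_t(b), computed recursively from b + (-b) = 0. *)
  have lN k : lam k (- b) \in G0.
    have [N] := ubnP k; elim: N k => // N IH k; rewrite ltnS => kN.
    case: k kN => [|k] kN; first by rewrite (lambda_0 L) ?rpred1 ?GS ?rpredN.
    have := lambda_add L k.+1 (GS _ bG) (GS (- b) _).
    rewrite rpredN subrr lam0 // => /(_ bG).
    rewrite big_ord_recl /= subn0 (lambda_0 L) ?GS // mul1r => /esym/eqP.
    rewrite addr_eq0 => /eqP->; rewrite rpredN rpred_sum // => i _.
    rewrite rpredM // IH // /bump /= add1n subSS.
    by apply: leq_trans kN; rewrite ltnS leq_subr.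
  move=> k; rewrite (lambda_add L) ?GS ?rpredN // rpred_sum // => i _.
  by rewrite rpredM.
move=> a b /TP[aG la] /TP[bG lb]; apply/TP; split; first by rewrite rpredM.
move=> k; have [P _ ->] := lambda_mul L k; rewrite ?GS //.
by apply: zeval_closed => i; case: fintype.split.
Qed.

(** * Newton's identities and the generators of Gamma *)

Lemma mdeg_var_pow j k : monalg.mdeg (var_pow j k) = k.
Proof.
rewrite (@monalg.mdegEw _ _ [fset j]%fset).
  by rewrite big_seq_fset1 var_powE eqxx mul1n.
by apply/fsubsetP => i; rewrite -cmE_neq0 var_powE in_fset1 [i == j]eq_sym; case: (j == i).
Qed.

Lemma mdeg_div_var_pow m j k : (k <= m j)%N ->
  monalg.mdeg (divcm m (var_pow j k)) = (monalg.mdeg m - k)%N.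
Proof. by move=> km; rewrite -[in RHS](divcm_var_powK km) monalg.mdegM mdeg_var_pow addnK. Qed.

Lemma mdeg_ge m j : (m j <= monalg.mdeg m)%N.
Proof. by rewrite -{2}(divcm_var_powK (leqnn (m j))) monalg.mdegM mdeg_var_pow leq_addl. Qed.

Lemma mexp_ones m n :
  (mexp m == nseq n 1%N) = (monalg.mdeg m == n) && all (fun j => m j <= 1)%N (mvars m).
Proof.
have -> : all (fun j => m j <= 1)%N (mvars m) = all (pred1 1%N) (mexp m).
  rewrite all_map; apply: eq_in_all => j; rewrite mem_mvars /=.
  by case: (m j) => [|[|]].
apply/eqP/andP => [E|[/eqP dm /all_pred1P E]].
  rewrite -sumn_mexp E sumn_nseq mul1n eqxx; split=> //.
  by apply/all_pred1P; rewrite size_nseq.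
by rewrite E; congr nseq; rewrite -dm -sumn_mexp [in RHS]E sumn_nseq mul1n.
Qed.

(** Only i = a-1 and i = a contribute, with opposite signs; for a = 0 the first is absent. *)
Lemma alternating_pair_sum N a : (a < N)%N ->
  \sum_(i < N) (-1) ^+ i * ((i <= a) && (a <= i.+1))%N%:R = (a == 0)%N%:R :> int.
Proof.
elim: N a => [//|N IH] [|a]; rewrite ltnS => aN; rewrite big_ord_recl /= expr0 mul1r.
  by rewrite big1 ?addr0 // => i _; rewrite mulr0.
under eq_bigr => i _ do rewrite /bump /= add1n exprS mulN1r mulNr !ltnS.
by rewrite sumrN IH // ltnS leqn0 subrr.
Qed.

(** Newton's identity between elementary symmetric functions and power sums. Fix a variable x_j of
    [m]: removing x_j^(i+1) can leave a squarefree monomial only if i+1 is m_j or m_j - 1, and these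
    two terms cancel unless m_j = 1. *)
Lemma elem_newton n :
  qsM (nseq n.+1 1%N) *+ n.+1 =
  \sum_(i < n.+1) qsM (nseq (n - i) 1%N) * ((-1) ^+ i * qsM [:: i.+1]).
Proof.
have pos k : all (leq 1) (nseq k 1%N) by rewrite all_nseq orbT.
apply/funext => m; rewrite ps_muln ps_sumf qsME // mexp_ones.
transitivity (\sum_(i < n.+1) \sum_(j <- mvars m) ((-1) ^+ i *
    ((i < m j)%N && (mexp (divcm m (var_pow j i.+1)) == nseq (n - i) 1%N))%:R : int)); last first.
  apply: eq_bigr => i _.
  have -> : qsM (nseq (n - i) 1%N) * ((-1) ^+ i * qsM [:: i.+1]) =
     (qsM (nseq (n - i) 1%N) * qsM [:: i.+1]) *~ ((-1) ^+ i).
    by rewrite mulrCA -mulrzr rmorphXn rmorphN1 mulrC.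
  rewrite ps_mulz ps_mul_qsM1 // mulrC mulr_sumr [RHS]big_mkcond /=.
  apply: eq_bigr => j _; case: ifP => _; rewrite ?mulr0 //.
  by rewrite qsME.
rewrite exchange_big /=.
have [dm|dm] := eqVneq (monalg.mdeg m) n.+1; last first.
  rewrite mul0rn big1 // => j _; rewrite big1 // => i _.
  case: ltnP => im; last by rewrite mulr0.
  rewrite mexp_ones mdeg_div_var_pow //; have := ltn_ord i; rewrite ltnS => lin.
  have -> : (monalg.mdeg m - i.+1 == n - i)%N = false; last by rewrite mulr0.
  apply/negbTE; apply: contra dm => /eqP E; apply/eqP.
  move: (mdeg_ge m j) E im; move: (monalg.mdeg m) (m j) => d a; move: lin. lia.
rewrite /=.
transitivity (\sum_(j <- mvars m) (all (fun j => m j <= 1)%N (mvars m))%:R : int).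
  case: (boolP (all _ _)) => [sq|_]; last by rewrite mul0rn big1.
  rewrite -natr_sum -mulr_natl mulr1; congr (_%:R).
  rewrite -dm -sumn_mexp sumnE big_map.
  by apply: eq_big_seq => j jm; have := allP sq j jm; move: jm; rewrite mem_mvars;
    case: (m j) => [|[|]].
apply: eq_big_seq => j jm.
have mj : (0 < m j)%N by rewrite lt0n -mem_mvars.
(* Squarefreeness away from x_j does not depend on [i], so it factors out of the alternating sum. *)
pose rest := all (fun k => (k == j) || (m k <= 1))%N (mvars m).
have ltm : ((m j).-1 < n.+1)%N by rewrite -dm prednK ?mdeg_ge.
transitivity (\sum_(i < n.+1) (-1) ^+ i *
    ((i <= (m j).-1) && ((m j).-1 <= i.+1))%N%:R * rest%:R : int).
  rewrite -mulr_suml alternating_pair_sum // -natrM mulnb; congr (nat_of_bool _)%:R.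
  apply/allP/andP => [h|[mj1 /allP h] k km].
    split; first by have := h j jm; case: (m j) mj => [|[|]].
    by apply/allP => k km; rewrite h ?orbT.
  have := h k km; case: eqP => [->|] //= _.
  by move: mj1; case: (m j) => [|[|]].
apply: eq_bigr => i _; rewrite -mulrA -natrM mulnb; congr (_ * (nat_of_bool _)%:R).
rewrite -ltnS prednK //; case: (ltnP i (m j)) => //= im.
rewrite mexp_ones mdeg_div_var_pow // dm subSS eqxx /=.
apply/andP/allP => [[mi /allP h] k|h].
  rewrite mem_mvars divcmE var_powE => km.
  have kv : k \in mvars m by rewrite mem_mvars; apply: contraNneq km => ->.
  have := h k kv; case: eqP => [->|] /=; first by rewrite eqxx; lia.
  by rewrite eq_sym => /eqP/negPf->; lia.
have h' k : (divcm m (var_pow j i.+1) k <= 1)%N.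
  have [/h //|] := boolP (k \in mvars (divcm m (var_pow j i.+1))).
  by rewrite mem_mvars negbK => /eqP->.
split; first by have := h' j; rewrite divcmE var_powE eqxx; move: (m j) => a; lia.
apply/allP => k km; have := h' k; rewrite divcmE var_powE.
by rewrite eq_sym; case: eqP => //= _; rewrite mul0n subn0.
Qed.

Lemma mvars_div_var_pow m j :
  perm_eq (mvars m)
    (if (0 < m j)%N then j :: mvars (divcm m (var_pow j (m j)))
     else mvars (divcm m (var_pow j (m j)))).
Proof.
have jn : j \notin mvars (divcm m (var_pow j (m j))).
  by rewrite mem_mvars negbK divcmE var_powE eqxx mul1n subnn.
have e k : (k \in mvars m) = (k == j) && (0 < m j)%N ||
    (k \in mvars (divcm m (var_pow j (m j)))).
  rewrite !mem_mvars divcmE var_powE [k == j]eq_sym; case: (j =P k) => [<-|_] /=.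
    by rewrite mul1n subnn eqxx orbF lt0n.
  by rewrite mul0n subn0.
apply: uniq_perm; first exact: mvars_uniq.
  by case: ifP => _ /=; rewrite ?jn mvars_uniq.
by move=> k; rewrite e; case: ifP => _; rewrite ?inE ?andbT ?andbF.
Qed.

(** Each factor is 1 + 2xz + 2(xz)^2 + ... up to z^n, so every variable that occurs contributes one
    factor 2; [k <= n] keeps clear of the truncation. *)
Lemma gammaq_prod n N k m : (k <= n)%N ->
  (\prod_(i < N) ((1 + (ps_var i)%:P * 'X) * \poly_(l < n.+1) (ps_var i ^+ l)))`_k m =
  ((monalg.mdeg m == k) && all (fun j => j < N)%N (mvars m))%:R *+ 2 ^ size (mvars m).
Proof.
elim: N k m => [|N IH] k m kn.
  have -> : all (fun j => j < 0)%N (mvars m) = (m == mone).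
    rewrite -monalg.mdeg_eq0 -sumn_mexp /mexp.
    have := mexp_gt0 m; rewrite /mexp; case: (mvars m) => //= j s /andP[mj _].
    by move: mj; case: (m j).
  rewrite big_ord0 coef1 ps_muln [in LHS]/GRing.one /= /ps_one.
  have [->|m1] := eqVneq m mone; last by rewrite andbF !mul0rn.
  by rewrite monalg.mdeg1 andbT /mvars mdom1 eq_sym.
rewrite big_ord_recr /= coefMr ps_sumf.
pose c l := if (l == 0)%N then 1%N else 2%N.
have coefT l : (l <= n)%N ->
    ((1 + (ps_var N)%:P * 'X) * \poly_(l < n.+1) (ps_var N ^+ l))`_l
    = ps_sum [set var_pow N l]%classic *+ c l.
  move=> ln; rewrite mulrDl mul1r coefD coef_poly ltnS ln -mulrA coefCM.
  rewrite coefXM -ps_var_exp; case: l ln => [|l] ln /=.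
    by rewrite mulr0 addr0 /c mulr1n.
  by rewrite coef_poly ltnS (ltnW ln) -exprS /c /= mulr2n.
pose a := m N; pose m' := divcm m (var_pow N a).
pose term l : int := if (l <= a)%N then ((monalg.mdeg (divcm m (var_pow N l)) == k - l)%N &&
    all (fun j => j < N)%N (mvars (divcm m (var_pow N l))))%:R
      *+ 2 ^ size (mvars (divcm m (var_pow N l))) *+ c l else 0.
transitivity (\sum_(l < k.+1) term l).
  apply: eq_bigr => l _; have lk : (l <= k)%N by rewrite -ltnS.
  rewrite coefT ?(leq_trans lk) // mulrnAr ps_muln ps_mul_var_pow /term -/a.
  by case: ifP => _; rewrite ?mul0rn // IH // (leq_trans (leq_subr _ _)).
(* For smaller [l] the variable x_N would be left over, although the remaining factors only involve
   the earlier ones; for larger [l] its power does not divide [m]. *)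
have term0 l : l != a -> term l = 0.
  rewrite /term; case: ltngtP => // la _.
  have -> : all (fun j => j < N)%N (mvars (divcm m (var_pow N l))) = false.
    apply/negbTE/allPn; exists N; last by rewrite ltnn.
    by rewrite mem_mvars divcmE var_powE eqxx mul1n subn_eq0 -ltnNge.
  by rewrite andbF !mul0rn.
have [ak|ka] := leqP a k; last first.
  rewrite big1 => [|l _]; last by apply: term0; have := ltn_ord l; lia.
  have -> : (monalg.mdeg m == k) = false; last by rewrite mul0rn.
  by have := mdeg_ge m N; rewrite -/a; lia.
have ak' : (a < k.+1)%N by [].
rewrite (bigD1 (Ordinal ak')) //= big1 ?addr0 => [|l la]; last exact: term0.
rewrite /term leqnn -/m'.
have szm : (2 ^ size (mvars m) = 2 ^ size (mvars m') * c a)%N.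
  have := perm_size (mvars_div_var_pow m N); rewrite -/a -/m' => ->.
  by rewrite /c; case: (a) => [|a']; rewrite ?muln1 //= expnS mulnC.
have allm : all (fun j => j < N.+1)%N (mvars m) = all (fun j => j < N)%N (mvars m').
  transitivity (all (fun j => j < N.+1)%N (mvars m')).
    have /perm_all-> := mvars_div_var_pow m N; rewrite -/a -/m'.
    by case: ifP => //= _; rewrite ltnSn.
  apply: eq_in_all => j jm'; rewrite ltnS leq_eqVlt; case: (j =P N) => // jN.
  by move: jm'; rewrite mem_mvars divcmE var_powE jN eqxx mul1n subnn.
rewrite -mulrnA -szm allm mdeg_div_var_pow //; congr (((_ && _)%:R) *+ _).
by have := mdeg_ge m N; rewrite -/a; lia.
Qed.

Lemma gammaqE n m : gammaq n m = (monalg.mdeg m == n)%:R *+ 2 ^ size (mexp m).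
Proof.
have le_max (s : seq nat) j : j \in s -> (j <= \max_(i <- s) i)%N.
  by move=> js; apply: leq_bigmax_seq.
rewrite /gammaq gammaq_prod // size_map (_ : all _ _ = true) ?andbT //.
apply/allP => j; rewrite mem_sort => jm; rewrite ltnS; exact: le_max.
Qed.

Lemma psring_mulIn k (f g : psring) : f *+ k.+1 = g *+ k.+1 -> f = g.
Proof.
move=> E; apply/funext => m; have : (f *+ k.+1) m = (g *+ k.+1) m by rewrite E.
by rewrite !ps_muln -(mulr_natr (f m)) -(mulr_natr (g m)); apply: mulIf; rewrite pnatr_eq0.
Qed.

(** * Descent of the lambda-structure along theta, and the subring Gamma *)

Section Main.
Variable theta : psring -> psring.
Hypothesis thetaP : is_theta theta.
Variables lamQ PsiQ : nat -> psring -> psring.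
Hypothesis lamQ_ring : lambda_ring_on QSym lamQ.
Hypothesis PsiQ_adams : adams_on QSym lamQ PsiQ.
Hypothesis PsiQ_M : forall n al, (0 < n)%N -> composition al ->
  PsiQ n (qsM al) = qsM (scale_comp n al).

(** The values of [PsiQ] are given on the M alone; [adams_add] and [adams_1] extend the agreement to
    [QSym]. *)
Lemma PsiQ_frob n : {in QSym, PsiQ n.+1 =1 frob n.+1}.
Proof.
have PD : {in QSym &, {morph PsiQ n.+1 : x y / x + y}}.
  have [S ES] := subring_pack (lambda_subringP lamQ_ring).
  by move: lamQ_ring PsiQ_adams; rewrite ES => L A; apply: (adams_add L A).
have P1 : PsiQ n.+1 1 = 1.
  have [S ES] := subring_pack (lambda_subringP lamQ_ring).
  by move: lamQ_ring PsiQ_adams; rewrite ES => L A; apply: (adams_1 L A).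
apply: QSym_ind.
- by rewrite frob0 (morph_on0 PD).
- by rewrite P1 frob1.
- by move=> al cal; rewrite PsiQ_M // frob_qsM //; case/andP: cal.
- by move=> f g fQ gQ Ef Eg; rewrite (morph_onB PD) // frobB Ef Eg.
Qed.

Lemma theta_newton n : {in QSym, forall f, theta (lamQ n.+1 f) *+ n.+1 =
  \sum_(i < n.+1) theta (lamQ (n - i)%N f) * ((-1) ^+ i * adamsPhi i.+1 (theta f))}.
Proof.
have [[_ t1 tD tM] _] := thetaP.
have [S ES] := subring_pack (lambda_subringP lamQ_ring).
move=> f fQ; have lQ k : lamQ k f \in QSym by apply: (lambda_closed lamQ_ring).
have sQ i : (-1) ^+ i * frob i.+1 f \in QSym.
  have := frob_QSym (ltn0Sn i) fQ; rewrite ES => h.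
  by rewrite rpredM // rpredX // rpredN1.
rewrite -(morph_on_muln tD) // PsiQ_adams // (morph_on_sum tD) => [|i _]; last first.
  have : lamQ (n - i)%N f * ((-1) ^+ i * frob i.+1 f) \in QSym.
    by move: (lQ (n - i)%N) (sQ i); rewrite ES => h1 h2; apply: rpredM.
  by rewrite -PsiQ_frob.
apply: eq_bigr => i _; rewrite PsiQ_frob // tM //; congr (_ * _).
have N1 : (-1 : psring) ^+ i \in QSym by rewrite ES rpredX // rpredN1.
rewrite tM ?frob_QSym // theta_frob //; congr (_ * _).
have Q1 : (1 : psring) \in QSym by rewrite ES rpred1.
elim: {sQ N1} (i : nat) => [|k IH]; first by rewrite !expr0.
by rewrite !exprS tM ?IH ?(morph_onN tD) ?t1 // ES ?rpredX // rpredN1.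
Qed.

(** By [theta_newton], a positive multiple of each theta (lambda^n f) is determined by theta f and
    the earlier ones, and power series are torsion-free. *)
Lemma theta_lamQ_wd n : {in QSym &, forall f g, theta f = theta g ->
  theta (lamQ n f) = theta (lamQ n g)}.
Proof.
move=> f g fQ gQ E; have [N] := ubnP n; elim: N n => // N IH [|n] nN.
  by rewrite !(lambda_0 lamQ_ring).
apply: (@psring_mulIn n); rewrite !theta_newton // E; apply: eq_bigr => i _.
by rewrite IH //; lia.
Qed.

(** [xget] picks a preimage under [theta], with default 0 if there is none; on [PQSym] the choice is
    immaterial by [theta_lamQ_wd]. *)
Definition lamP n (y : psring) : psring :=
  theta (lamQ n (xget 0 [set f | f \in QSym /\ theta f = y]%classic)).

Lemma lamPE n : {in QSym, forall f, lamP n (theta f) = theta (lamQ n f)}.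
Proof.
move=> f fQ; rewrite /lamP.
have [|gQ Eg] := @xgetPex _ 0 [set h | h \in QSym /\ theta h = theta f]%classic.
  by exists f.
exact: theta_lamQ_wd.
Qed.

Lemma lamP_ring : lambda_ring_on PQSym lamP.
Proof.
apply: (lambda_ring_quotient lamQ_ring) lamPE; first by case: thetaP.
exact: theta_image.
Qed.

(** Both sides obey Newton's recursion, because Psi^k(p_1) = p_k. *)
Lemma lamQ_elem n : lamQ n (qsM [:: 1%N]) = qsM (nseq n 1%N).
Proof.
have Q1 : qsM [:: 1%N] \in QSym by apply: qsM_QSym.
have [N] := ubnP n; elim: N n => // N IH [|n] nN.
  rewrite (lambda_0 lamQ_ring) //; apply/funext => m; rewrite qsME //.
  congr (nat_of_bool _)%:R; apply/eqP/eqP => [->|E]; first exact: mexp1.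
  by apply/eqP; rewrite -monalg.mdeg_eq0 -sumn_mexp E.
apply: (@psring_mulIn n); rewrite PsiQ_adams // elem_newton; apply: eq_bigr => i _.
by rewrite IH ?PsiQ_M //= ?muln1 //; lia.
Qed.

(** On both sides a monomial of degree [n] has coefficient 2 to the number of its variables. *)
Lemma theta_elem n : (0 < n)%N -> theta (qsM (nseq n 1%N)) = gammaq n.
Proof.
move=> n0; apply/funext => m; rewrite theta_qsM //; last first.
  by rewrite /composition all_nseq orbT andbT; case: n n0.
by rewrite theta_coef_nseq1 ?mexp_gt0 // sumn_mexp gammaqE eq_sym.
Qed.

Lemma lamP_gammaq n : (0 < n)%N -> lamP n (gammaq 1) = gammaq n.
Proof.
by move=> n0; rewrite -theta_elem // lamPE ?lamQ_elem ?theta_elem //; apply: qsM_QSym.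
Qed.

Lemma gammaq_PQSym n : (0 < n)%N -> gammaq n \in PQSym.
Proof.
move=> n0; rewrite -theta_elem //; have [[tS _ _ _] _] := thetaP.
by apply/tS/qsM_QSym; rewrite /composition all_nseq orbT andbT; case: n n0.
Qed.

Lemma GammaP f : reflect (forall S : {pred psring}, subring_closed S ->
  (forall n, (0 < n)%N -> gammaq n \in S) -> f \in S) (f \in Gamma).
Proof. exact: asboolP. Qed.

Lemma Gamma_gammaq n : (0 < n)%N -> gammaq n \in Gamma.
Proof. by move=> n0; apply/GammaP => S _; apply. Qed.

Lemma Gamma_subring : subring_closed Gamma.
Proof.
split=> [|f g /GammaP fG /GammaP gG|f g /GammaP fG /GammaP gG]; apply/GammaP => S HS qS;
  have [S1 SB SM] := HS.
- exact: S1.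
- by apply: SB; [apply: fG|apply: gG].
- by apply: SM; [apply: fG|apply: gG].
Qed.

Lemma Gamma_lambda_subring : lambda_subring PQSym lamP Gamma.
Proof.
have sub : {subset Gamma <= PQSym}.
  move=> f /GammaP; apply; first exact: lambda_subringP lamP_ring.
  exact: gammaq_PQSym.
have lG n : lamP n (gammaq 1) \in Gamma.
  case: n => [|n]; last by rewrite lamP_gammaq // Gamma_gammaq.
  by rewrite (lambda_0 lamP_ring) ?gammaq_PQSym //; case: Gamma_subring.
split=> //; first exact: Gamma_subring.
apply: (lambda_subring_generated lamP_ring (gammaq_PQSym (n := 1) isT) sub Gamma_subring lG).
move=> T HT TG f /GammaP; apply=> // n n0; rewrite -lamP_gammaq //; exact: TG.
Qed.

End Main.

Theorem theorem3p2
  (theta : psring -> psring) (theta_spec : is_theta theta)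
  (lamQ PsiQ : nat -> psring -> psring)
  (lamQ_ring : lambda_ring_on QSym lamQ)
  (PsiQ_adams : adams_on QSym lamQ PsiQ)
  (PsiQ_M : forall n al, (0 < n)%N -> composition al ->
     PsiQ n (qsM al) = qsM (scale_comp n al)) :
  exists lamP : nat -> psring -> psring,
    [/\ lambda_ring_on PQSym lamP,
        lambda_hom_on QSym lamQ PQSym lamP theta,
        exists Phi : nat -> psring -> psring,
          adams_on PQSym lamP Phi /\
          forall n, (0 < n)%N ->
            is_Phi theta n (Phi n) /\
            forall g, is_Phi theta n g -> {in PQSym, g =1 Phi n}
      & lambda_subring PQSym lamP Gamma].
Proof.
pose lam := lamP theta lamQ.
have lamE := lamPE theta_spec lamQ_ring PsiQ_adams PsiQ_M.
exists lam; split.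
- exact: (lamP_ring theta_spec lamQ_ring PsiQ_adams PsiQ_M).
- by split; [case: theta_spec|move=> n f fQ; rewrite /lam lamE].
(* The Adams identity for [adamsPhi] is [theta_newton] read at a preimage [f]. *)
- exists adamsPhi; split=> [_ /(theta_image theta_spec)[f fQ <-] n|n n0].
    rewrite /lam lamE // (theta_newton theta_spec lamQ_ring PsiQ_adams PsiQ_M) //.
    by apply: eq_bigr => i _; rewrite lamE.
  by split; [exact: adamsPhi_is_Phi|move=> g; exact: is_Phi_uniq].
- exact: (Gamma_lambda_subring theta_spec lamQ_ring PsiQ_adams PsiQ_M).
Qed.
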